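(* Let $\mathbb{SU}=\prod_{n=1}^\infty SU(n)$ and let $\mathcal{S}(\mathbb{SU})$ be its space of closed subgroups. For a comeager set of $G\in\mathcal{S}(\mathbb{SU})$ there are infinitely many $n\in\mathbb{N}$ such that $\pi_n(G)=SU(n)$.
   Context: $\mathbb{N}=\{1,2,3,\dots\}$. $\mathbb{SU}$ carries the product topology, metrized by $d(x,y)=\sum_n 2^{-n}d_n(x(n),y(n))$ where $d_n\le 1$ is a biinvariant metric on $SU(n)$. $\mathcal{S}(\mathbb{SU})$ is the set of nonempty compact subgroups of $\mathbb{SU}$ with the Hausdorff metric induced by $d$ (a compact metric space; its topology is the Vietoris topology). $\pi_n:\mathbb{SU}\to SU(n)$ is the $n$-th coordinate projection. Every compact metrizable group is isomorphic to an element of $\mathcal{S}(\mathbb{SU})$. *)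

(* Defs.v *)
From HB Require Import structures.
From mathcomp Require Import all_boot all_order all_algebra spectral.
From mathcomp Require Import all_classical all_reals all_analysis.
From mathcomp Require Import complex.

Set Implicit Arguments.
Unset Strict Implicit.
Unset Printing Implicit Defensive.

Import Order.TTheory GRing.Theory Num.Theory.
Import numFieldNormedType.Exports.

Local Open Scope classical_set_scope.
Local Open Scope complex_scope.
Local Open Scope ring_scope.

(* The usual topology of the complex numbers, given by the modulus. *)
HB.instance Definition _ (R : realType) :=
  PseudoPointedMetric.copy R[i] (R[i] : numClosedFieldType)^o.

Section SU.
Variables (R : realType) (n : nat).

Record SU := MkSU {
  SUval : 'M[R[i]]_n;
  SUvalP : (SUval \is unitarymx) && (\det SUval == 1) }.

HB.instance Definition _ := [isSub for SUval].
HB.instance Definition _ := [Choice of SU by <:].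

HB.instance Definition _ :=
  Topological.copy SU (initial_topology (SUval : SU -> 'M[R[i]]_n)).

Lemma SU_unitary (U : SU) : SUval U \is unitarymx.
Proof. by case: U => ? /= /andP[]. Qed.

Lemma SU_det (U : SU) : \det (SUval U) = 1.
Proof. by case: U => ? /= /andP[_ /eqP]. Qed.

Lemma SU1_subproof :
  ((1%:M : 'M[R[i]]_n) \is unitarymx) && (\det (1%:M : 'M[R[i]]_n) == 1).
Proof. by rewrite det1 eqxx andbT; apply/unitarymxP; rewrite trmx1 map_mx1 mulmx1. Qed.

Lemma SUM_subproof (U V : SU) :
  (SUval U *m SUval V \is unitarymx) && (\det (SUval U *m SUval V) == 1).
Proof. by rewrite mul_unitarymx ?SU_unitary// det_mulmx !SU_det mulr1 eqxx. Qed.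

Lemma SUV_subproof (U : SU) :
  (invmx (SUval U) \is unitarymx) && (\det (invmx (SUval U)) == 1).
Proof.
by rewrite det_inv SU_det invr1 eqxx invmx_unitary ?trmxC_unitary SU_unitary.
Qed.

Definition SU1 : SU := MkSU SU1_subproof.
Definition SUmul (U V : SU) : SU := MkSU (SUM_subproof U V).
Definition SUinv (U : SU) : SU := MkSU (SUV_subproof U).

Lemma SUunit (U : SU) : SUval U \in unitmx.
Proof. by rewrite unitarymx_unit// SU_unitary. Qed.

Lemma SUmulA : associative SUmul.
Proof. by move=> U V W; apply: val_inj; rewrite /= mulmxA. Qed.
Lemma SUmul1g : left_id SU1 SUmul.
Proof. by move=> U; apply: val_inj; rewrite /= mul1mx. Qed.
Lemma SUmulg1 : right_id SU1 SUmul.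
Proof. by move=> U; apply: val_inj; rewrite /= mulmx1. Qed.
Lemma SUmulVg : left_inverse SU1 SUinv SUmul.
Proof. by move=> U; apply: val_inj; rewrite /= mulVmx ?SUunit. Qed.
Lemma SUmulgV : right_inverse SU1 SUinv SUmul.
Proof. by move=> U; apply: val_inj; rewrite /= mulmxV ?SUunit. Qed.

HB.instance Definition _ :=
  isGroup.Build SU SUmulA SUmul1g SUmulg1 SUmulVg SUmulgV.

(* [bdist_nbhs] says that the metric induces the topology of SU(n). *)
Record biinv_metric := BiinvMetric {
  bdist :> SU -> SU -> R;
  bdistxx : forall x, bdist x x = 0;
  bdist_positivity : forall x y, bdist x y = 0 -> x = y;
  bdist_sym : forall x y, bdist x y = bdist y x;
  bdist_triangle : forall y x z, bdist x z <= bdist x y + bdist y z;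
  bdist_nbhs : forall (x : SU) (A : set SU),
    nbhs x A <-> exists2 e : R, 0 < e & [set y | bdist x y < e] `<=` A;
  bdistMl : forall a x y, bdist (a * x)%g (a * y)%g = bdist x y;
  bdistMr : forall a x y, bdist (x * a)%g (y * a)%g = bdist x y;
  bdist_le1 : forall x y, bdist x y <= 1 }.

End SU.

(* The factor of index [n : nat] is SU(n + 1), so that the factors are
   SU(1), SU(2), ... *)
Section SUprod.
Variable R : realType.

Definition SUprod : Type := prod_topology (fun n : nat => SU R n.+1).

HB.instance Definition _ := Topological.copy SUprod
  (prod_topology (fun n : nat => SU R n.+1)).

Definition SUprod1 : SUprod := fun n => 1%g.
Definition SUprod_mul (x y : SUprod) : SUprod := fun n => (x n * y n)%g.
Definition SUprod_inv (x : SUprod) : SUprod := fun n => (x n)^-1%g.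

Lemma SUprod_mulA : associative SUprod_mul.
Proof. by move=> x y z; apply: functional_extensionality_dep => n; exact: mulgA. Qed.
Lemma SUprod_mul1g : left_id SUprod1 SUprod_mul.
Proof. by move=> x; apply: functional_extensionality_dep => n; exact: mul1g. Qed.
Lemma SUprod_mulg1 : right_id SUprod1 SUprod_mul.
Proof. by move=> x; apply: functional_extensionality_dep => n; exact: mulg1. Qed.
Lemma SUprod_mulVg : left_inverse SUprod1 SUprod_inv SUprod_mul.
Proof. by move=> x; apply: functional_extensionality_dep => n; exact: mulVg. Qed.
Lemma SUprod_mulgV : right_inverse SUprod1 SUprod_inv SUprod_mul.
Proof. by move=> x; apply: functional_extensionality_dep => n; exact: mulgV. Qed.

HB.instance Definition _ := isGroup.Build SUprod
  SUprod_mulA SUprod_mul1g SUprod_mulg1 SUprod_mulVg SUprod_mulgV.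

(* Nonemptiness is part of [group_closed], which contains [1 \in A]. *)
Record compact_subgroup := CompactSubgroup {
  csval :> set SUprod;
  cs_compact : compact csval;
  cs_group : group_closed (mem csval) }.

End SUprod.

Section hausdorff_dist.
Variables (R : realType) (T : Type) (dist : T -> T -> R).

Definition dist_to_set (a : T) (B : set T) : R := inf [set dist a b | b in B].

Definition excess (A B : set T) : R := sup [set dist_to_set a B | a in A].

Definition hausdorff_dist (A B : set T) : R :=
  Num.max (excess A B) (excess B A).

Hypothesis dist_ge0 : forall x y, 0 <= dist x y.
Hypothesis distxx : forall x, dist x x = 0.
Hypothesis dist_triangle : forall y x z, dist x z <= dist x y + dist y z.
Variable M : R.
Hypothesis dist_leM : forall x y, dist x y <= M.

Lemma dist_to_set_le (B : set T) a b : B b -> dist_to_set a B <= dist a b.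
Proof.
by move=> Bb; apply: ge_inf; [exists 0 => _ [c _ <-]|exists b].
Qed.

Lemma dist_to_set_ge0 (B : set T) a : 0 <= dist_to_set a B.
Proof.
have [->|/set0P[b Bb]] := eqVneq B set0; first by rewrite /dist_to_set image_set0 inf0.
by apply: lb_le_inf; [exists (dist a b), b|move=> _ [c _ <-]].
Qed.

Lemma dist_to_set_lt (B : set T) a (e : R) : B !=set0 -> 0 < e ->
  exists2 b, B b & dist a b < dist_to_set a B + e.
Proof.
move=> [b0 Bb0] e0.
have [] := @inf_adherent R [set dist a b | b in B] e e0.
  by split; [exists (dist a b0), b0|exists 0 => _ [c _ <-]].
by move=> _ [b Bb <-] h; exists b.
Qed.

Lemma excess_has_ubound A B : B !=set0 ->
  has_ubound [set dist_to_set a B | a in A].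
Proof.
by move=> [b Bb]; exists M => _ [a _ <-]; apply: le_trans (dist_to_set_le a Bb) _.
Qed.

Lemma le_excess A B a : A a -> B !=set0 ->
  dist_to_set a B <= excess A B.
Proof.
by move=> Aa B0; apply: ub_le_sup; [exact: excess_has_ubound|exists a].
Qed.

Lemma excess_ge0 A B : A !=set0 -> B !=set0 -> 0 <= excess A B.
Proof.
by move=> [a Aa] B0; apply: le_trans (le_excess Aa B0); exact: dist_to_set_ge0.
Qed.

Lemma excess_le A B e : A !=set0 -> (forall a, A a ->
  dist_to_set a B <= e) -> excess A B <= e.
Proof.
move=> [a Aa] h; apply: ge_sup; first by exists (dist_to_set a B), a.
by move=> _ [c Ac <-]; exact: h.
Qed.

Lemma excess_triangle A B C : A !=set0 -> B !=set0 -> C !=set0 ->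
  excess A C <= excess A B + excess B C.
Proof.
move=> A0 B0 C0; apply: excess_le => // a Aa; apply/ler_addgt0Pr => e e0.
have e20 : 0 < e / 2 by rewrite divr_gt0.
have [b Bb ab] := dist_to_set_lt a B0 e20.
have [c Cc bc] := dist_to_set_lt b C0 e20.
apply: le_trans (dist_to_set_le a Cc) _; apply: le_trans (dist_triangle b a c) _.
rewrite [e]splitr addrACA lerD//.
  by apply: le_trans (ltW ab) _; rewrite lerD2r le_excess.
by apply: le_trans (ltW bc) _; rewrite lerD2r le_excess.
Qed.

Lemma excessxx A : A !=set0 -> excess A A = 0.
Proof.
move=> A0; apply/eqP; rewrite eq_le excess_ge0// andbT; apply: excess_le => // a Aa.
by apply: le_trans (dist_to_set_le a Aa) _; rewrite distxx.
Qed.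

Lemma hausdorff_distxx A : A !=set0 -> hausdorff_dist A A = 0.
Proof. by move=> A0; rewrite /hausdorff_dist maxxx excessxx. Qed.

Lemma hausdorff_dist_sym A B : hausdorff_dist A B = hausdorff_dist B A.
Proof. by rewrite /hausdorff_dist maxC. Qed.

Lemma hausdorff_dist_triangle B A C : A !=set0 -> B !=set0 -> C !=set0 ->
  hausdorff_dist A C <= hausdorff_dist A B + hausdorff_dist B C.
Proof.
move=> A0 B0 C0; rewrite /hausdorff_dist ge_max; apply/andP; split.
  by apply: le_trans (excess_triangle A0 B0 C0) _; rewrite lerD// le_max lexx.
apply: le_trans (excess_triangle C0 B0 A0) _.
by rewrite addrC lerD// le_max lexx orbT.
Qed.

Lemma hausdorff_dist_eq0 A B : A !=set0 -> B !=set0 -> hausdorff_dist A B = 0 ->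
  forall a, A a -> forall e : R, 0 < e -> exists2 b, B b & dist a b < e.
Proof.
move=> A0 B0 AB0 a Aa e e0; have [b Bb ab] := dist_to_set_lt a B0 e0.
exists b => //; apply: lt_le_trans ab _; rewrite gerDr.
by apply: le_trans (le_excess Aa B0) _; rewrite -AB0 /hausdorff_dist le_max lexx.
Qed.

End hausdorff_dist.

Section SUdist.
Variables (R : realType) (d : forall n : nat, biinv_metric R n.+1).

Definition SUdist (x y : SUprod R) : R :=
  limn (series (fun n => 2^-1 ^+ n.+1 * d n (x n) (y n))).

Lemma bdist_ge0 n (b : biinv_metric R n) x y : 0 <= b x y.
Proof.
rewrite -(@pmulrn_lge0 _ _ 2)// -(bdistxx b x).
by rewrite (le_trans (bdist_triangle b y _ _))// bdist_sym -mulr2n.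
Qed.

Let term_ge0 (x y : SUprod R) n : 0 <= 2^-1 ^+ n.+1 * d n (x n) (y n).
Proof. by rewrite mulr_ge0 ?exprn_ge0 ?bdist_ge0. Qed.

Let geom_cvg : cvgn (series (geometric (2^-1 : R) 2^-1)).
Proof.
by apply: is_cvg_geometric_series; rewrite ger0_norm// invf_lt1// ltr1n.
Qed.

Let term_le (x y : SUprod R) n :
  2^-1 ^+ n.+1 * d n (x n) (y n) <= geometric (2^-1 : R) 2^-1 n.
Proof. by rewrite /geometric/= -exprS ler_piMr ?exprn_ge0 ?bdist_le1. Qed.

Lemma is_cvg_SUdist (x y : SUprod R) :
  cvgn (series (fun n => 2^-1 ^+ n.+1 * d n (x n) (y n))).
Proof.
apply: series_le_cvg (term_le x y) geom_cvg => // n.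
by rewrite /geometric/= mulr_ge0 ?exprn_ge0.
Qed.

Lemma SUdist_ge_term (x y : SUprod R) n :
  2^-1 ^+ n.+1 * d n (x n) (y n) <= SUdist x y.
Proof.
apply: (@le_trans _ _ (series (fun n => 2^-1 ^+ n.+1 * d n (x n) (y n)) n.+1)).
  by rewrite /series/= big_nat_recr//= lerDr sumr_ge0.
apply: (nondecreasing_cvgn_le _ (@is_cvg_SUdist x y)).
apply/nondecreasing_seqP => m.
by rewrite /series/= big_nat_recr//= lerDl.
Qed.

Lemma SUdist_ge0 (x y : SUprod R) : 0 <= SUdist x y.
Proof. exact: le_trans (SUdist_ge_term x y 0). Qed.

Lemma SUdist_bounded (x y : SUprod R) :
  SUdist x y <= limn (series (geometric (2^-1 : R) 2^-1)).
Proof. exact: (lim_series_le (@is_cvg_SUdist x y) geom_cvg (term_le x y)). Qed.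

Lemma SUdistxx (x : SUprod R) : SUdist x x = 0.
Proof.
rewrite /SUdist (_ : series _ = cst 0) ?lim_cst//.
by apply/funext => n; rewrite /series/= big1// => i _; rewrite bdistxx mulr0.
Qed.

Lemma SUdist_sym (x y : SUprod R) : SUdist x y = SUdist y x.
Proof.
by rewrite /SUdist; congr (limn (series _)); apply/funext => n; rewrite bdist_sym.
Qed.

Lemma SUdist_triangle (y x z : SUprod R) : SUdist x z <= SUdist x y + SUdist y z.
Proof.
have cxy := @is_cvg_SUdist x y; have cyz := @is_cvg_SUdist y z.
rewrite /SUdist -lim_seriesD//.
apply: lim_series_le; [exact: is_cvg_SUdist|exact: is_cvg_seriesD|] => n.
by rewrite -mulrDr ler_wpM2l ?exprn_ge0 ?bdist_triangle.
Qed.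

Lemma SUdist_positivity (x y : SUprod R) : SUdist x y = 0 -> x = y.
Proof.
move=> xy0; apply: functional_extensionality_dep => n.
apply: (@bdist_positivity _ _ (d n)); apply/eqP; rewrite eq_le bdist_ge0 andbT.
have := SUdist_ge_term x y n.
by rewrite xy0 pmulr_rle0// exprn_gt0.
Qed.

Lemma SU_hausdorff n : hausdorff_space (SU R n.+1).
Proof.
move=> x y /(_ [set z | d n x z < d n x y / 2] [set z | d n y z < d n x y / 2]).
have [xy0 _|xyN0] := eqVneq (d n x y) 0; first exact: bdist_positivity xy0.
have e0 : 0 < d n x y / 2 by rewrite divr_gt0// lt_neqAle eq_sym xyN0 bdist_ge0.
case.
- by apply/(bdist_nbhs (d n)); exists (d n x y / 2).
- by apply/(bdist_nbhs (d n)); exists (d n x y / 2).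
move=> z /= [xz yz]; have := bdist_triangle (d n) z x y.
by rewrite leNgt (bdist_sym (d n) z y) [ltRHS]splitr ltrD.
Qed.

Lemma SUprod_hausdorff : hausdorff_space (SUprod R).
Proof. exact: (@hausdorff_product nat (fun n => SU R n.+1) SU_hausdorff). Qed.

Lemma closed_SUdist (A : set (SUprod R)) a : closed A ->
  (forall e : R, 0 < e -> exists2 b, A b & SUdist a b < e) -> A a.
Proof.
move=> clA h.
have /choice[b hb] : forall k : nat, exists b, A b /\ SUdist a b < k.+1%:R^-1.
  by move=> k; have [//|b Ab ab] := h k.+1%:R^-1; exists b.
apply: (@closed_cvg _ _ \oo _ b _ clA _ a); first by apply: nearW => k; case: (hb k).
apply/cvg_sup => N U [V] [[W] oW <-] WaN WU.
apply: (filterS WU) => {U WU}; rewrite nbhs_simpl/=.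
have /(bdist_nbhs (d N))[e e0 eW] : nbhs (a N) W by exact: open_nbhs_nbhs.
have c0 : 0 < 2^-1 ^+ N.+1 * e by rewrite mulr_gt0// exprn_gt0.
near=> k; apply: eW => /=.
have p0 : 0 < (2^-1 : R) ^+ N.+1 by rewrite exprn_gt0.
rewrite -(ltr_pM2l p0); apply: le_lt_trans (SUdist_ge_term a (b k) N) _.
case: (hb k) => _ /lt_trans; apply; near: k.
exact: near_infty_natSinv_lt (PosNum c0).
Unshelve. all: by end_near. Qed.

End SUdist.

Lemma compact_subgroup_neq0 (R : realType) (A : compact_subgroup R) :
  (A : set (SUprod R)) !=set0.
Proof. by exists 1%g; have [+ _] := cs_group A; rewrite inE. Qed.

(* The space of compact subgroups, with the Hausdorff metric induced by
   [SUdist d]. *)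
Definition subgroup_space (R : realType)
  (d : forall n : nat, biinv_metric R n.+1) : Type := compact_subgroup R.

Section subgroup_space.
Variables (R : realType) (d : forall n : nat, biinv_metric R n.+1).
Local Notation S := (subgroup_space d).

HB.instance Definition _ := gen_eqMixin S.
HB.instance Definition _ := gen_choiceMixin S.

Definition subgroup_dist (A B : S) : R :=
  hausdorff_dist (SUdist d) (csval A) (csval B).

Lemma subgroup_distxx (A : S) : subgroup_dist A A = 0.
Proof.
rewrite /subgroup_dist.
apply: (hausdorff_distxx (SUdist_ge0 d) (SUdistxx d) (SUdist_bounded d)).
exact: compact_subgroup_neq0.
Qed.

Lemma subgroup_dist_sym (A B : S) : subgroup_dist A B = subgroup_dist B A.
Proof. exact: hausdorff_dist_sym. Qed.

Lemma subgroup_dist_triangle (B A C : S) :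
  subgroup_dist A C <= subgroup_dist A B + subgroup_dist B C.
Proof.
rewrite /subgroup_dist.
by apply: (hausdorff_dist_triangle (SUdist_ge0 d)
  (SUdist_triangle d) (SUdist_bounded d)); exact: compact_subgroup_neq0.
Qed.

Lemma subgroup_dist_positivity (A B : S) : subgroup_dist A B = 0 -> A = B.
Proof.
have sub (A' B' : S) : subgroup_dist A' B' = 0 -> csval A' `<=` csval B'.
  move=> AB0 a Aa; apply: (closed_SUdist (d := d)).
    by apply: compact_closed; [exact: SUprod_hausdorff|exact: cs_compact].
  by apply: (hausdorff_dist_eq0 (SUdist_ge0 d) (SUdist_bounded d)
    _ _ AB0) => //; exact: compact_subgroup_neq0.
move=> AB0; have /seteqP : csval A `<=>` csval B.
  by split; apply: sub => //; rewrite subgroup_dist_sym.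
case: A {AB0} => A cA gA; case: B => B cB gB /= eAB; subst B.
by congr CompactSubgroup; exact: Prop_irrelevance.
Qed.

HB.instance Definition _ := isMetric.Build R S
  subgroup_distxx subgroup_dist_positivity subgroup_dist_sym
  subgroup_dist_triangle.

End subgroup_space.

Definition comeager (T : topologicalType) (A : set T) : Prop :=
  exists2 U : nat -> set T,
    (forall i, open (U i) /\ dense (U i)) & \bigcap_i U i `<=` A.

(* Main.v *)
(** Every [SU n] is isolated among its closed subgroups, by the Solovay-Kitaev
    argument.  Let [H] be a subgroup that is dense up to [s ^+ 2].  If [g], [h]
    in [H] approximate, up to [O(s ^+ 2)], elements [1 + A], [1 + B] at distance
    [O(s)] from the identity, then the commutator of [g] and [h] is
    [1 + (A B - B A) + O(s ^+ 3)].  Since su(n) is spanned by commutators, this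
    makes [H] dense up to [O(s ^+ 3)], hence up to [(s / 2) ^+ 2] when [s] is
    small, and by iteration dense.  It follows that the set of the [G] with
    [pi_n G = SU n] is open for every [n].  The union of these sets over
    [n >= m] is dense: a given [G] is approximated by the subgroup that has the
    same first [N] coordinates and arbitrary later ones, which is compact since
    every [SU n] is. *)
Require Import Defs.
From HB Require Import structures.
From mathcomp Require Import all_boot all_order all_algebra spectral.
From mathcomp Require Import all_classical all_reals all_analysis.
From mathcomp Require Import perm complex ring lra.

Set Implicit Arguments.
Unset Strict Implicit.
Unset Printing Implicit Defensive.

Import Order.TTheory GRing.Theory Num.Theory.
Import numFieldNormedType.Exports.

Local Open Scope classical_set_scope.
Local Open Scope ring_scope.
Local Open Scope complex_scope.
Local Open Scope sesquilinear_scope.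

Import Normc.

(** * The entrywise l1 norm *)

Section MatrixNorm.
Variables (R : rcfType) (n : nat).
Local Notation C := R[i].
Implicit Types A B : 'M[C]_n.

Lemma normc_ge0 (z : C) : 0 <= normc z.
Proof. by case: z => a b; exact: sqrtr_ge0. Qed.

Lemma normcJ (z : C) : normc (Num.conj z) = normc z.
Proof. by apply: complexI; exact: (norm_conjC z). Qed.

Lemma normc_real (x : R) : normc x%:C = `|x|.
Proof. by rewrite /normc /= expr0n addr0 sqrtr_sqr. Qed.

Lemma le_normc_sum (I : Type) (r : seq I) (F : I -> C) :
  normc (\sum_(i <- r) F i) <= \sum_(i <- r) normc (F i).
Proof.
elim/big_ind2 : _ => //; first by rewrite normc0.
by move=> x1 x2 y1 y2 h1 h2; apply: le_trans (le_normcD _ _) (lerD h1 h2).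
Qed.

Definition mxnorm A : R := \sum_i \sum_j normc (A i j).

Lemma mxnorm_ge0 A : 0 <= mxnorm A.
Proof. by apply: sumr_ge0 => i _; apply: sumr_ge0 => j _; exact: normc_ge0. Qed.

Lemma mxnorm0 : mxnorm 0 = 0.
Proof.
by rewrite /mxnorm big1 // => i _; rewrite big1 // => j _; rewrite mxE normc0.
Qed.

Lemma mxnormN A : mxnorm (- A) = mxnorm A.
Proof. by apply: eq_bigr => i _; apply: eq_bigr => j _; rewrite mxE normcN. Qed.

Lemma mxnormD A B : mxnorm (A + B) <= mxnorm A + mxnorm B.
Proof.
rewrite -big_split; apply: ler_sum => i _; rewrite -big_split.
by apply: ler_sum => j _; rewrite mxE; exact: le_normcD.
Qed.

Lemma mxnormB A B : mxnorm (A - B) <= mxnorm A + mxnorm B.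
Proof. by rewrite -[mxnorm B]mxnormN mxnormD. Qed.

Lemma mxnorm_distC A B : mxnorm (A - B) = mxnorm (B - A).
Proof. by rewrite -mxnormN opprB. Qed.

Lemma mxnormZ (c : C) A : mxnorm (c *: A) = normc c * mxnorm A.
Proof.
rewrite /mxnorm mulr_sumr; apply: eq_bigr => i _; rewrite mulr_sumr.
by apply: eq_bigr => j _; rewrite mxE normcM.
Qed.

Lemma mxnorm_row A i : \sum_j normc (A i j) <= mxnorm A.
Proof.
rewrite /mxnorm [leRHS](bigD1 i) //= lerDl; apply: sumr_ge0 => k _.
by apply: sumr_ge0 => j _; exact: normc_ge0.
Qed.

Lemma mxnorm_coef A i j : normc (A i j) <= mxnorm A.
Proof.
apply: le_trans (mxnorm_row A i); rewrite [leRHS](bigD1 j) //= lerDl.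
by apply: sumr_ge0 => k _; exact: normc_ge0.
Qed.

Lemma mxnormM A B : mxnorm (A *m B) <= mxnorm A * mxnorm B.
Proof.
rewrite {1}/mxnorm [leRHS]mulr_suml; apply: ler_sum => i _.
apply: (@le_trans _ _ (\sum_j \sum_k normc (A i k) * normc (B k j))).
  apply: ler_sum => j _; rewrite mxE; apply: le_trans (le_normc_sum _ _) _.
  by apply: ler_sum => k _; rewrite normcM.
rewrite exchange_big mulr_suml; apply: ler_sum => k _ /=.
by rewrite -mulr_sumr; apply: ler_wpM2l (mxnorm_row B k); exact: normc_ge0.
Qed.

Lemma mxnorm_trC A : mxnorm (A ^t*) = mxnorm A.
Proof.
rewrite /mxnorm exchange_big; apply: eq_bigr => i _.
by apply: eq_bigr => j _; rewrite !mxE normcJ.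
Qed.

Lemma mxnorm_le A (e : R) : (forall i j, normc (A i j) <= e) ->
  mxnorm A <= (n * n)%:R * e.
Proof.
move=> h; apply: (@le_trans _ _ (\sum_(i < n) \sum_(j < n) e)).
  by apply: ler_sum => i _; apply: ler_sum => j _.
by rewrite !sumr_const !card_ord -mulrnA mulr_natl.
Qed.

(** The rows of a unitary matrix are unit vectors for the Hermitian product. *)
Lemma normc_unitary A i j : A \is unitarymx -> normc (A i j) <= 1.
Proof.
move=> /unitarymxP /matrixP /(_ i i); rewrite !mxE eqxx => uA.
rewrite -lecR -[X in X <= _]/(`|A i j|) -[X in _ <= X]/(1 : C).
suff : `|A i j| ^+ 2 <= 1 by rewrite expr_le1.
rewrite -[leRHS]/(true%:R) -uA (bigD1 j) //= !mxE -normCK lerDl; apply: sumr_ge0 => k _.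
by rewrite !mxE -normCK exprn_ge0.
Qed.

Lemma mxnorm_unitary A : A \is unitarymx -> mxnorm A <= (n * n)%:R.
Proof.
by move=> uA; rewrite -[leRHS]mulr1; apply: mxnorm_le => i j; exact: normc_unitary.
Qed.

End MatrixNorm.

(** * Rotations in a quaternionic plane *)

Section Rotation.
Variables (R : realType) (n : nat).
Local Notation C := R[i].
Implicit Types P Q : 'M[C]_n.

(* On the range of the projection [- P ^+ 2], the matrices [P], [Q] and
   [P *m Q] multiply like the quaternions i, j, k; they vanish on its
   orthogonal complement. *)
Definition quaternionic P Q :=
  [/\ P ^t* = - P, Q ^t* = - Q, P *m P *m P = - P, Q *m Q *m Q = - Q &
      P *m P = Q *m Q /\ P *m Q = - (Q *m P)].

(** When [P ^+ 3 = - P], these polynomials in [P] are closed under product, so that computations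
    with rotations reduce to three real coefficients. *)
Definition quadmx P (a b c : R) : 'M[C]_n :=
  a%:C%:M + b%:C *: P + c%:C *: (P *m P).

Lemma quadmxM P a b c a' b' c' : P *m P *m P = - P ->
  quadmx P a b c *m quadmx P a' b' c' =
  quadmx P (a * a') (a * b' + b * a' - b * c' - c * b')
    (a * c' + c * a' + b * b' - c * c').
Proof.
move=> P3.
rewrite /quadmx !(mulmxDl, mulmxDr) !mul_scalar_mx !mul_mx_scalar.
rewrite -!(scalemxAl, scalemxAr) !mulmxA !P3 !mulNmx !scalerA.
have CD (u v : R) : (u + v)%:C = u%:C + v%:C by exact: rmorphD.
have CB (u v : R) : (u - v)%:C = u%:C - v%:C by exact: rmorphB.
have CM (u v : R) : (u * v)%:C = u%:C * v%:C by exact: rmorphM.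
rewrite !(CB, CD, CM).
move: a%:C b%:C c%:C a'%:C b'%:C c'%:C (P *m P) => x y z x' y' z' S.
apply/matrixP => i j.
by rewrite !mxE; case: (i == j); rewrite ?mulr1n ?mulr0n; ring.
Qed.

Lemma quadmx1 P : quadmx P 1 0 0 = 1%:M.
Proof. by rewrite /quadmx !scale0r !addr0. Qed.

Lemma quadmx_affine P t : quadmx P 1 t 0 = 1%:M + t%:C *: P.
Proof. by rewrite /quadmx scale0r addr0. Qed.

Lemma quadmx_trC P a b c : P ^t* = - P ->
  (quadmx P a b c) ^t* = quadmx P a (- b) c.
Proof.
move=> Ps; have PPs : (P *m P) ^t* = P *m P.
  by rewrite trmx_mul map_mxM Ps mulNmx mulmxN opprK.
have conjR (x : R) : Num.conj (x%:C : C) = x%:C by exact: conjc_real.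
rewrite /quadmx !linearD /= !map_mxD tr_scalar_mx map_scalar_mx /= conjR.
rewrite !linearZ /= !map_mxZ /= !conjR Ps PPs.
by rewrite scalerN rmorphN scaleNr.
Qed.

(** The matrices [1 + t P] and [1 - t P] are conjugate. The conjugating matrix acts as [Q], which
    anticommutes with [P], on the range of [- P ^+ 2], and as the identity on the orthogonal
    complement, where [P] vanishes. *)
Lemma det_quadmxN P Q t : quaternionic P Q ->
  \det (quadmx P 1 (- t) 0) = \det (quadmx P 1 t 0).
Proof.
move=> [_ _ P3 Q3 [PQ2 PQ]].
(* [V], of inverse [W], conjugates [P] to [- P]. *)
pose V := Q + 1%:M + P *m P; pose W := - Q + 1%:M + P *m P.
have QPP : P *m P *m Q = - Q by rewrite PQ2 Q3.
have PPQ : Q *m (P *m P) = - Q by rewrite PQ2 mulmxA Q3.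
have VW : V *m W = 1%:M.
  rewrite /V /W !(mulmxDl, mulmxDr, mulmxN, mulNmx, mul1mx, mulmx1).
  rewrite PPQ QPP !mulmxA P3 mulNmx -PQ2.
  by move: (P *m P) => S; apply/matrixP => i j; rewrite !mxE; ring.
have VP : V *m quadmx P 1 t 0 = quadmx P 1 (- t) 0 *m V.
  have CN : (- t)%:C = - t%:C by exact: rmorphN.
  rewrite !quadmx_affine CN scaleNr /V.
  rewrite !(mulmxDl, mulmxDr, mulmx1, mul1mx) ?mulNmx -!(scalemxAl, scalemxAr).
  rewrite !mulmxA P3 PQ.
  move: t%:C (Q *m P) (P *m P) => u S T.
  by apply/matrixP => i j; rewrite !mxE; ring.
have dV : \det V != 0.
  by apply/eqP => dV; have := congr1 determinant VW;
    rewrite det_mulmx dV mul0r det1 => /eqP; rewrite eq_sym oner_eq0.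
by have /esym := congr1 determinant VP; rewrite !det_mulmx mulrC => /(mulfI dV).
Qed.

(* [b] is the sine of an angle, [c] is 1 minus its cosine and [t] the tangent of
   its half: [1 + b P + c P ^+ 2] is then the Cayley transform
   [(1 - t P)^-1 (1 + t P)], whose determinant is 1 by [det_quadmxN]. *)
Lemma cayley_param (b : R) : `|b| <= 1 -> exists c t g : R,
  [/\ `|c| <= b ^+ 2, c * 2 - c ^+ 2 = b ^+ 2, b = t * (2 - c), c = t * b &
      g * (1 + t ^+ 2) = t ^+ 2].
Proof.
move=> b1; have b21 : b ^+ 2 <= 1 by rewrite -real_normK ?num_real // expr_le1.
pose r := Num.sqrt (1 - b ^+ 2).
have r0 : 0 <= r by exact: sqrtr_ge0.
have r2 : r ^+ 2 = 1 - b ^+ 2 by rewrite sqr_sqrtr // subr_ge0.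
have r1 : 1 + r != 0 by rewrite gt_eqF // ltr_pwDl.
have cE : 1 - r = b ^+ 2 / (1 + r).
  by apply: (mulIf r1); rewrite mulfVK //; lra.
pose t := b / (1 + r).
have t1 : 1 + t ^+ 2 != 0 by rewrite gt_eqF // ltr_pwDl // sqr_ge0.
exists (1 - r), t, (t ^+ 2 / (1 + t ^+ 2)); split.
- rewrite cE ger0_norm ?divr_ge0 ?sqr_ge0 ?addr_ge0 //.
  by rewrite ler_pdivrMr ?ltr_pwDl // ler_peMr ?sqr_ge0 // lerDl.
- by lra.
- by rewrite /t; field.
- by rewrite cE /t; field.
- by rewrite mulfVK.
Qed.

(** An algebraic substitute for the exponential of a multiple of [P]: an exact element of the group
    that is [1 + b P] up to second order in [b]. *)
Lemma quaternionic_rotation P Q (b : R) : quaternionic P Q -> `|b| <= 1 ->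
  exists U : SU R n, exists2 c : R, `|c| <= b ^+ 2 &
    SUval U = quadmx P 1 b c.
Proof.
move=> qPQ /cayley_param [c [t [g [cb c2 tE cE gE]]]].
have [Ps _ P3 _ _] := qPQ.
have uM : quadmx P 1 b c \is unitarymx.
  apply/unitarymxP; rewrite quadmx_trC // quadmxM //.
  have -> : 1 * - b + b * 1 - b * c - c * - b = 0 by ring.
  have -> : 1 * c + c * 1 + b * - b - c * c = 0.
    by apply: (@etrans _ _ (c * 2 - c ^+ 2 - b ^+ 2)); [ring|rewrite c2 subrr].
  by rewrite mulr1 quadmx1.
(* [1 + g P ^+ 2] inverts [(1 - t P) (1 + t P) = 1 - t ^+ 2 P ^+ 2]. Hence [1 - t P] has nonzero
   determinant, which is cancelled from the determinants of [e2] below. *)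
have e1 : quadmx P 1 (- t) 0 *m (quadmx P 1 t 0 *m quadmx P 1 0 g) = 1%:M.
  rewrite !(quadmxM _ _ _ _ _ _ P3) -(quadmx1 P).
  apply: (f_equal3 (quadmx P)); [by ring|by ring|].
  apply: (@etrans _ _ (g * (1 + t ^+ 2) - t ^+ 2)); first by ring.
  by rewrite gE subrr.
have e2 : quadmx P 1 (- t) 0 *m quadmx P 1 b c = quadmx P 1 t 0.
  rewrite (quadmxM _ _ _ _ _ _ P3).
  apply: (f_equal3 (quadmx P)); first by ring.
  - by rewrite {1}tE; ring.
  - by rewrite {1 2}cE; ring.
have dM : \det (quadmx P 1 b c) == 1.
  have := congr1 determinant e2; rewrite -(det_quadmxN t qPQ) det_mulmx.
  rewrite -[X in _ = X]mulr1 => /mulfI -> //; apply/eqP => dt.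
  have := congr1 determinant e1; rewrite det_mulmx dt mul0r det1 => /esym/eqP.
  by rewrite oner_eq0.
have UP : (quadmx P 1 b c \is unitarymx) && (\det (quadmx P 1 b c) == 1).
  by rewrite uM.
by exists (MkSU UP), c.
Qed.

End Rotation.

(** * Commutators near the identity *)

Section Approximation.
Variables (R : realType) (n : nat).
Local Notation C := R[i].
Local Notation k := ((n * n)%:R : R).
Implicit Types (A B Y P Q : 'M[C]_n) (g h : SU R n) (H : set (SU R n)).

Lemma mxnormD_le A B (a b : R) : mxnorm A <= a -> mxnorm B <= b ->
  mxnorm (A + B) <= a + b.
Proof. by move=> hA hB; apply: le_trans (mxnormD _ _) (lerD hA hB). Qed.

Lemma mxnormB_le A B (a b : R) : mxnorm A <= a -> mxnorm B <= b ->
  mxnorm (A - B) <= a + b.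
Proof. by move=> hA hB; apply: le_trans (mxnormB _ _) (lerD hA hB). Qed.

Lemma mxnormM_le A B (a b : R) : mxnorm A <= a -> mxnorm B <= b ->
  mxnorm (A *m B) <= a * b.
Proof.
move=> hA hB; apply: le_trans (mxnormM _ _) _.
by apply: ler_pM => //; exact: mxnorm_ge0.
Qed.

Lemma mxnorm_SU g : mxnorm (SUval g) <= k.
Proof. by apply: mxnorm_unitary; exact: SU_unitary. Qed.

Lemma SUvalM g h : SUval (g * h)%g = SUval g *m SUval h. Proof. by []. Qed.

Lemma SUval1 : SUval (1%g : SU R n) = 1%:M. Proof. by []. Qed.

Lemma SUvalMV g : SUval g *m SUval g^-1%g = 1%:M.
Proof. by rewrite -SUvalM mulgV. Qed.

Lemma SUvalVM g : SUval g^-1%g *m SUval g = 1%:M.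
Proof. by rewrite -SUvalM mulVg. Qed.

Lemma mxnorm_SUB g h :
  mxnorm (SUval g - SUval h) <= k * mxnorm (SUval (h^-1 * g)%g - 1%:M).
Proof.
have -> : SUval g - SUval h = SUval h *m (SUval (h^-1 * g)%g - 1%:M).
  by rewrite mulmxBr mulmx1 -SUvalM mulVKg.
by apply: mxnormM_le => //; exact: mxnorm_SU.
Qed.

Lemma mxnorm_SUVB g h :
  mxnorm (SUval (h^-1 * g)%g - 1%:M) <= k * mxnorm (SUval g - SUval h).
Proof.
have -> : SUval (h^-1 * g)%g - 1%:M = SUval h^-1%g *m (SUval g - SUval h).
  by rewrite mulmxBr SUvalVM.
by apply: mxnormM_le => //; exact: mxnorm_SU.
Qed.

(** The left side is [(x y - y x) x' y'], and subtracting 1 from [x] and from [y] does not change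
    their additive commutator. *)
Lemma commutator_sub1 (x y x' y' : 'M[C]_n) : x *m x' = 1%:M -> y *m y' = 1%:M ->
  x *m y *m x' *m y' - 1%:M =
  ((x - 1%:M) *m (y - 1%:M) - (y - 1%:M) *m (x - 1%:M)) *m (x' *m y').
Proof.
move=> xx yy.
have -> : (x - 1%:M) *m (y - 1%:M) - (y - 1%:M) *m (x - 1%:M) = x *m y - y *m x.
  rewrite !(mulmxBl, mulmxBr, mul1mx, mulmx1).
  by apply/matrixP => i j; do ![rewrite ![in LHS]mxE | rewrite ![in RHS]mxE]; ring.
by rewrite mulmxBl -!mulmxA; congr (_ - _); rewrite (mulmxA x) xx mul1mx yy.
Qed.

(** Two errors of order [s ^+ 3] arise: replacing [g - 1] and [h - 1] by [A] and [B] in the additive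
    commutator, and dropping the trailing factor [w], which is [1 + O(s)] while the additive
    commutator is [O(s ^+ 2)]. *)
Lemma commutator_approx g h A B (c s : R) : 0 <= s <= 1 -> 0 <= c ->
  mxnorm A <= c * s -> mxnorm B <= c * s ->
  mxnorm (SUval g - 1%:M - A) <= c * s ^+ 2 ->
  mxnorm (SUval h - 1%:M - B) <= c * s ^+ 2 ->
  mxnorm (SUval (g * h * g^-1 * h^-1)%g - 1%:M - (A *m B - B *m A)) <=
    (6 * c ^+ 2 * k + 4 * c ^+ 3 * (k * (k + 1))) * s ^+ 3.
Proof.
move=> /andP[s0 s1] c0 nA nB gA hB.
set A' := SUval g - 1%:M in gA; set B' := SUval h - 1%:M in hB.
set w := SUval (g^-1 * h^-1)%g.
have k0 : 0 <= k by rewrite ler0n.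
have s2 : c * s ^+ 2 <= c * s.
  by rewrite expr2 mulrA ler_piMr ?mulr_ge0.
have nA' : mxnorm A' <= 2 * (c * s).
  rewrite -[A'](subrK A) mulr_natl mulr2n.
  by apply: mxnormD_le => //; exact: le_trans s2.
have nB' : mxnorm B' <= 2 * (c * s).
  rewrite -[B'](subrK B) mulr_natl mulr2n.
  by apply: mxnormD_le => //; exact: le_trans s2.
have nw : mxnorm w <= k by exact: mxnorm_SU.
have nw1 : mxnorm (w - 1%:M) <= k * (k * (2 * (c * s)) + 2 * (c * s)).
  (* As [w] is the inverse of [h g], [w - 1 = - w (h g - 1)], and
     [h g - 1 = h (g - 1) + (h - 1)]. *)
  have -> : w - 1%:M = - (w *m (SUval h *m A' + B')).
    rewrite /A' /B' mulmxBr mulmx1 subrKA mulmxBr mulmx1 -!SUvalM /w.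
    by rewrite mulgA mulgVK mulVg opprB.
  rewrite mxnormN; apply: mxnormM_le nw _; apply: mxnormD_le => //.
  by apply: mxnormM_le nA'; exact: mxnorm_SU.
have -> : SUval (g * h * g^-1 * h^-1)%g - 1%:M - (A *m B - B *m A) =
   ((A' - A) *m B' + A *m (B' - B) - ((B' - B) *m A' + B *m (A' - A))) *m w +
   (A *m B - B *m A) *m (w - 1%:M).
  rewrite !SUvalM (commutator_sub1 (SUvalMV g) (SUvalMV h)).
  rewrite -/A' -/B' -SUvalM -/w.
  have -> : A' *m B' - B' *m A' = (A' - A) *m B' + A *m (B' - B) -
      ((B' - B) *m A' + B *m (A' - A)) + (A *m B - B *m A).
    rewrite !(mulmxBl, mulmxBr).
    move: (A' *m B') (B' *m A') (A *m B) (B *m A) (A *m B') (B *m A') => a b d e f g'.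
    by apply/matrixP => i j; rewrite !mxE; ring.
  by rewrite mulmxDl [_ *m (w - _)]mulmxBr mulmx1 -addrA.
apply: (@le_trans _ _
  ((c * s ^+ 2 * (2 * (c * s)) + c * s * (c * s ^+ 2) +
   (c * s ^+ 2 * (2 * (c * s)) + c * s * (c * s ^+ 2))) * k +
   (c * s * (c * s) + c * s * (c * s)) *
     (k * (k * (2 * (c * s)) + 2 * (c * s))))).
  apply: mxnormD_le; apply: mxnormM_le => //; apply: mxnormB_le;
    by [apply: mxnormD_le; apply: mxnormM_le | apply: mxnormM_le].
by rewrite le_eqVlt (_ : _ == _) //; apply/eqP; ring.
Qed.

End Approximation.

(** * Directions approximable by a subgroup *)

Section Directions.
Variables (R : realType) (n : nat).
Local Notation C := R[i].
Local Notation k := ((n * n)%:R : R).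
Implicit Types (A B P Q : 'M[C]_n) (g h : SU R n) (H : set (SU R n)).
Implicit Types (Y : R -> set 'M[C]_n).

Definition is_subgroup H := [/\ H 1%g, forall g h, H g -> H h -> H (g * h)%g &
  forall g, H g -> H g^-1%g].

(** The error is measured on the quotient [h^-1 * g]: it is a group element near the identity, which
    the next round of approximation takes as its target. *)
Definition dense_upto (e : R) H :=
  forall g, exists2 h, H h & mxnorm (SUval (h^-1 * g)%g - 1%:M) <= e.

(* A subgroup that is dense up to [s ^+ 2] contains approximations of
   [1 + A], [A \in Y s], that are better by a factor of order [s]. *)
Definition approximable Y := exists2 c : R, 0 <= c &
  forall s H, 0 < s <= 1 -> is_subgroup H -> dense_upto (s ^+ 2) H ->
  forall A, Y s A -> mxnorm A <= c * s ^+ 2 /\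
    exists2 h, H h & mxnorm (SUval h - 1%:M - A) <= c * s ^+ 3.

Lemma approximable_sub Y Y' : (forall s, Y s `<=` Y' s) ->
  approximable Y' -> approximable Y.
Proof.
move=> YY' [c c0 h]; exists c => // s H s1 sH dH A YA.
by apply: h => //; exact: YY'.
Qed.

Lemma approximable0 : approximable (fun _ => [set 0]).
Proof.
exists 0 => // s H s1 [H1 _ _] _ A ->; rewrite mxnorm0 mul0r; split=> //.
by exists 1%g => //; rewrite SUval1 subrr subr0 mxnorm0 mul0r.
Qed.

(** The product of the approximations of [1 + A] and [1 + B] approximates [1 + A + B], because the
    cross term is a product of two factors [O(s ^+ 2)], hence [O(s ^+ 4)]. *)
Lemma approximableD Y1 Y2 : approximable Y1 -> approximable Y2 ->
  approximable (fun s => [set A + B | A in Y1 s & B in Y2 s]).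
Proof.
move=> [c1 c10 h1] [c2 c20 h2].
have k0 : 0 <= k by rewrite ler0n.
exists (c1 + c2 + (c1 * k + c1 * (c2 + c2) + c2)).
  by rewrite !(addr_ge0, mulr_ge0).
move=> s H s1 sH dH _ [A YA] [B YB <-].
have /andP[s0 sle1] := s1; have s0' := ltW s0.
have [nA [g Hg gA]] := h1 s H s1 sH dH A YA.
have [nB [h Hh hB]] := h2 s H s1 sH dH B YB.
have s2 : 0 <= s ^+ 2 by exact: sqr_ge0.
have s3 : 0 <= s ^+ 3 by exact: exprn_ge0.
have s32 : s ^+ 3 <= s ^+ 2 by rewrite (exprSr s 2) ler_piMr.
have s43 : s ^+ 2 * s ^+ 2 <= s ^+ 3.
  by rewrite -exprD (exprSr s 3) ler_piMr.
split.
  apply: le_trans (mxnormD_le nA nB) _; rewrite -mulrDl.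
  by rewrite ler_wpM2r // lerDl !(addr_ge0, mulr_ge0).
have [_ HM _] := sH; exists (g * h)%g; first exact: HM.
have -> : SUval (g * h)%g - 1%:M - (A + B) =
    (SUval g - 1%:M - A) *m SUval h + A *m (SUval h - 1%:M) +
    (SUval h - 1%:M - B).
  rewrite SUvalM !mulmxBl mulmxBr mulmx1 mul1mx.
  move: (A *m SUval h) (SUval g *m SUval h) => S T.
  by apply/matrixP => i j; rewrite !mxE; ring.
have nh1 : mxnorm (SUval h - 1%:M) <= (c2 + c2) * s ^+ 2.
  rewrite -[SUval h - 1%:M](subrK B) mulrDl; apply: mxnormD_le nB.
  by apply: le_trans hB _; rewrite ler_wpM2l.
apply: (@le_trans _ _ (c1 * s ^+ 3 * k + c1 * s ^+ 2 * ((c2 + c2) * s ^+ 2) +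
  c2 * s ^+ 3)).
  apply: mxnormD_le hB; apply: mxnormD_le; apply: mxnormM_le => //.
  exact: mxnorm_SU.
have c43 : c1 * (c2 + c2) * (s ^+ 2 * s ^+ 2) <= c1 * (c2 + c2) * s ^+ 3.
  by rewrite ler_wpM2l // mulr_ge0 // addr_ge0.
have c3 : 0 <= (c1 + c2) * s ^+ 3 by rewrite mulr_ge0 // addr_ge0.
clear -c43 c3; lra.
Qed.

Lemma approximable_sum (T : Type) (r : seq T) (p : pred T)
    (Y : T -> R -> set 'M[C]_n) : (forall t, p t -> approximable (Y t)) ->
  approximable (fun s => [set \sum_(t <- r | p t) F t |
    F in [set F : T -> 'M[C]_n | forall t, p t -> Y t s (F t)]]).
Proof.
move=> aY; elim: r => [|t r IHr].
  by apply: approximable_sub approximable0 => s _ [F _ <-]; rewrite big_nil.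
have [pt|npt] := boolP (p t); last first.
  by apply: approximable_sub IHr => s _ [F YF <-]; rewrite big_cons (negPf npt); exists F.
apply: approximable_sub (approximableD (aY t pt) IHr) => s _ [F YF <-].
rewrite big_cons pt; exists (F t); first exact: (YF t pt).
by exists (\sum_(j <- r | p j) F j) => //; exists F.
Qed.

(* [x PQ] is the additive commutator of [s P] and [x / (2 s) Q], both of size
   [O(s)]. *)
Lemma approximable_quaternionic P Q : quaternionic P Q ->
  approximable (fun s => [set x%:C *: (P *m Q) | x in [set x : R | `|x| <= s ^+ 2]]).
Proof.
move=> qPQ; have [Ps Qs P3 Q3 [PQ2 PQ]] := qPQ.
have qQP : quaternionic Q P.
  by split=> //; split; [rewrite PQ2|rewrite PQ opprK].
pose p := mxnorm P + mxnorm (P *m P).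
pose q := mxnorm Q + mxnorm (Q *m Q).
have p0 : 0 <= p by rewrite addr_ge0 ?mxnorm_ge0.
have q0 : 0 <= q by rewrite addr_ge0 ?mxnorm_ge0.
have k0 : 0 <= k by rewrite ler0n.
(* A single constant meets all hypotheses of [commutator_approx]: [p] and [q] bound the sizes of the
   two rotations minus 1, and [k] the cost of translating the errors of [dense_upto] away from the
   identity. *)
have [c [c0 kc pc qc]] : exists c : R, [/\ 0 <= c, k <= c, p <= c & q <= c].
  by exists (k + p + q); split; lra.
pose c' := 6 * c ^+ 2 * k + 4 * c ^+ 3 * (k * (k + 1)).
have c'0 : 0 <= c' by rewrite /c' addr_ge0 // !mulr_ge0 ?exprn_ge0 ?addr_ge0.
have rot P' Q' (b s : R) : quaternionic P' Q' -> 0 < s <= 1 -> `|b| <= s ->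
    exists U : SU R n, exists2 d : R,
      SUval U - 1%:M = b%:C *: P' + d%:C *: (P' *m P') &
      mxnorm (SUval U - 1%:M) <= (mxnorm P' + mxnorm (P' *m P')) * s.
  move=> qPQ' /andP[s0 s1] bs.
  have [U [d db UE]] := quaternionic_rotation qPQ' (le_trans bs s1).
  have {}UE : SUval U - 1%:M = b%:C *: P' + d%:C *: (P' *m P').
    by rewrite UE /quadmx -[_ + _ + _ *: (P' *m P')]addrA addrAC subrr add0r.
  exists U, d => //; rewrite UE mulrDl.
  apply: mxnormD_le; rewrite mxnormZ normc_real mulrC.
    by rewrite ler_wpM2l ?mxnorm_ge0.
  rewrite ler_wpM2l ?mxnorm_ge0 //; apply: (le_trans db).
  rewrite -real_normK ?num_real // expr2; apply: (le_trans _ bs).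
  by rewrite ler_piMr // (le_trans bs).
exists (mxnorm (P *m Q) + c'); first by rewrite addr_ge0 ?mxnorm_ge0.
move=> s H s1 sH dH _ [x /= xs <-]; have /andP[s0 sle1] := s1.
have s2 : 0 <= s ^+ 2 by exact: sqr_ge0.
split.
  rewrite mxnormZ normc_real mulrC mulrDl.
  by rewrite (le_trans (ler_wpM2l _ xs)) ?mxnorm_ge0 // lerDl mulr_ge0.
have [U [d UE nU]] : exists U : SU R n, exists2 d : R,
      SUval U - 1%:M = s%:C *: P + d%:C *: (P *m P) &
      mxnorm (SUval U - 1%:M) <= p * s.
  by apply: (rot P Q) => //; rewrite ger0_norm // ltW.
have [V [f VE nV]] : exists V : SU R n, exists2 d : R,
      SUval V - 1%:M = (x / (2 * s))%:C *: Q + d%:C *: (Q *m Q) &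
      mxnorm (SUval V - 1%:M) <= q * s.
  apply: (rot Q P) => //; rewrite normrM normfV (gtr0_norm (_ : 0 < 2 * s)) ?mulr_gt0 //.
  rewrite ler_pdivrMr ?mulr_gt0 //; apply: le_trans xs _.
  by rewrite expr2 mulrCA ler_peMl ?mulr_ge0 ?ltW // ltr1n.
have [g Hg gU] := dH U; have [h Hh hV] := dH V.
have [_ HM HV] := sH.
exists (g * h * g^-1 * h^-1)%g.
  exact: HM _ _ (HM _ _ (HM _ _ Hg Hh) (HV _ Hg)) (HV _ Hh).
(* The equality is exact: the terms in [d] and [f] drop out, since [P *m P = Q *m Q] commutes with
   [P] and [Q]. What remains is [s * (x / (2 * s))] times [P Q - Q P = 2 P Q], whence the 2 in the
   sine of [V]. *)
have <- : (SUval U - 1%:M) *m (SUval V - 1%:M) -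
  (SUval V - 1%:M) *m (SUval U - 1%:M) = x%:C *: (P *m Q).
  rewrite UE VE -PQ2 !(mulmxDl, mulmxDr) -!(scalemxAl, scalemxAr).
  have -> : Q *m (P *m P) = P *m P *m Q by rewrite PQ2 mulmxA.
  rewrite [P *m (P *m P)]mulmxA (_ : Q *m P = - (P *m Q)); last by rewrite PQ opprK.
  rewrite !scalerA.
  have -> : x%:C = 2 * (s%:C * (x / (2 * s))%:C) :> C.
    rewrite -rmorphM -(rmorph_nat (real_complex R)) -rmorphM; congr _%:C.
    by field; rewrite gt_eqF.
  move: s%:C (x / (2 * s))%:C d%:C f%:C => a b e m.
  move: (P *m P *m P) (P *m P *m Q) (P *m P *m (P *m P)) (P *m Q) => S1 S2 S3 S4.
  by apply/matrixP => i j; rewrite !mxE; ring.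
have kcs : k * s ^+ 2 <= c * s ^+ 2.
  by rewrite ler_wpM2r.
apply: (@le_trans _ _ (c' * s ^+ 3)); last first.
  by rewrite ler_wpM2r ?lerDr ?mxnorm_ge0 // exprn_ge0 // ltW.
have s01 : 0 <= s <= 1 by rewrite ltW.
apply: commutator_approx => //.
- by apply: le_trans nU _; rewrite ler_wpM2r // ltW.
- by apply: le_trans nV _; rewrite ler_wpM2r // ltW.
- rewrite opprB addrA subrK mxnorm_distC; apply: le_trans kcs.
  by apply: le_trans (mxnorm_SUB _ _) _; rewrite ler_wpM2l.
- rewrite opprB addrA subrK mxnorm_distC; apply: le_trans kcs.
  by apply: le_trans (mxnorm_SUB _ _) _; rewrite ler_wpM2l.
Qed.

End Directions.

(** * Spanning su(n) *)

Section Decomposition.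
Variables (R : realType) (n : nat).
Local Notation C := R[i].
Implicit Types (A B W P Q : 'M[C]_n.+1) (g h : SU R n.+1) (H : set (SU R n.+1)).

(** The cyclic symmetry of the quaternions i, j, k. Since [approximable_quaternionic] treats the
    product of a pair, applying it to the successive pairs yields all three directions from a single
    pair. *)
Lemma quaternionic_next P Q : quaternionic P Q ->
  quaternionic Q (P *m Q) /\ Q *m (P *m Q) = P.
Proof.
move=> [Ps Qs P3 Q3 [PQ2 PQ]].
have QP : Q *m P = - (P *m Q) by rewrite PQ opprK.
have QPQ : Q *m (P *m Q) = P.
  by rewrite mulmxA QP mulNmx -mulmxA -PQ2 mulmxA P3 opprK.
have PQPQ : P *m Q *m (P *m Q) = P *m P by rewrite -mulmxA QPQ.
split=> //; split=> //.
- by rewrite trmx_mul map_mxM Ps Qs mulNmx mulmxN opprK.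
- by rewrite PQPQ mulmxA P3 mulNmx.
split; first by rewrite PQPQ PQ2.
by rewrite QPQ -mulmxA -PQ2 mulmxA P3 opprK.
Qed.

(** Together with their product, [antisym_mx] and [sym_mx] are the Pauli matrices times ['i], placed
    in the rows and columns [i] and [j]. *)
Definition antisym_mx (i j : 'I_n.+1) : 'M[C]_n.+1 := delta_mx i j - delta_mx j i.
Definition sym_mx (i j : 'I_n.+1) : 'M[C]_n.+1 :=
  'i *: (delta_mx i j + delta_mx j i).

Lemma antisym_sym_mx i j : i != j ->
  antisym_mx i j *m sym_mx i j = 'i *: (delta_mx i i - delta_mx j j).
Proof.
move=> ij; have ji : (j == i) = false by rewrite eq_sym (negPf ij).
rewrite /antisym_mx /sym_mx -scalemxAr mulmxDr !mulmxBl.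
rewrite !mul_delta_mx_cond !eqxx (negPf ij) ji !mulr0n !mulr1n.
by rewrite !subr0 !sub0r addrC.
Qed.

Lemma sym_antisym_mx i j : i != j ->
  sym_mx i j *m antisym_mx i j = - ('i *: (delta_mx i i - delta_mx j j)).
Proof.
move=> ij; have ji : (j == i) = false by rewrite eq_sym (negPf ij).
rewrite /antisym_mx /sym_mx -scalemxAl -scalerN mulmxBr !mulmxDl.
rewrite !mul_delta_mx_cond !eqxx (negPf ij) ji !mulr0n !mulr1n.
by rewrite !add0r !addr0 opprB.
Qed.

Lemma quaternionic_antisym_sym i j : i != j ->
  quaternionic (antisym_mx i j) (sym_mx i j).
Proof.
move=> ij; have ji : (j == i) = false by rewrite eq_sym (negPf ij).
have conji : Num.conj ('i : C) = - 'i by exact: conjCi.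
have conjd a b : (delta_mx a b : 'M[C]_n.+1) ^t* = delta_mx b a.
  by rewrite trmx_delta; apply/matrixP => p q; rewrite !mxE rmorph_nat.
pose T : 'M[C]_n.+1 := delta_mx i i + delta_mx j j.
have P2 : antisym_mx i j *m antisym_mx i j = - T.
  rewrite /antisym_mx mulmxBr !mulmxBl !mul_delta_mx_cond !eqxx (negPf ij) ji.
  by rewrite !mulr0n !mulr1n !subr0 !sub0r /T opprD addrC.
have Q2 : sym_mx i j *m sym_mx i j = - T.
  rewrite /sym_mx -scalemxAl -scalemxAr scalerA -expr2 sqr_i scaleN1r.
  rewrite mulmxDr !mulmxDl !mul_delta_mx_cond !eqxx (negPf ij) ji.
  by rewrite !mulr0n !mulr1n !add0r !addr0 /T addrC.
split.
- by rewrite /antisym_mx linearB /= map_mxB !conjd opprB.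
- rewrite /sym_mx linearZ /= map_mxZ linearD /= map_mxD !conjd conji scaleNr.
  by rewrite addrC.
- rewrite P2 mulNmx /T /antisym_mx mulmxDl !mulmxBr !mul_delta_mx_cond.
  rewrite !eqxx (negPf ij) ji.
  by rewrite !mulr0n !mulr1n !subr0 !sub0r.
- rewrite Q2 mulNmx /T /sym_mx -scalemxAr mulmxDl !mulmxDr !mul_delta_mx_cond.
  rewrite !eqxx (negPf ij) ji.
  by rewrite !mulr0n !mulr1n !add0r !addr0.
by rewrite P2 Q2 antisym_sym_mx // sym_antisym_mx // opprK.
Qed.

Lemma approximable_antisym i j : i != j -> approximable
  (fun s => [set x%:C *: antisym_mx i j | x in [set x : R | `|x| <= s ^+ 2]]).
Proof.
move=> /quaternionic_antisym_sym /quaternionic_next [q <-].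
exact: approximable_quaternionic.
Qed.

Lemma approximable_sym i j : i != j -> approximable
  (fun s => [set x%:C *: sym_mx i j | x in [set x : R | `|x| <= s ^+ 2]]).
Proof.
move=> /quaternionic_antisym_sym /quaternionic_next [/quaternionic_next [q qE] _].
by rewrite -{1}qE; exact: approximable_quaternionic.
Qed.

Lemma approximable_diag i j : i != j -> approximable
  (fun s => [set x%:C *: ('i *: (delta_mx i i - delta_mx j j) : 'M[C]_n.+1) |
    x in [set x : R | `|x| <= s ^+ 2]]).
Proof.
move=> ij; rewrite -antisym_sym_mx //.
exact: approximable_quaternionic (quaternionic_antisym_sym ij).
Qed.

Lemma skew_coef W i j : W ^t* = - W ->
  complex.Re (W j i) = - complex.Re (W i j) /\
  complex.Im (W j i) = complex.Im (W i j).
Proof.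
move=> /matrixP /(_ j i); rewrite !mxE -[Num.conj _]/(conjc _).
by case: (W i j) (W j i) => [a b] [c d] /= [-> /oppr_inj ->]; rewrite opprK.
Qed.

(** Moving the whole trace to the entry at [(0, 0)] leaves a traceless skew-Hermitian matrix,
    expanded here in the directions already treated. The sum runs over ordered pairs and [(i, j)],
    [(j, i)] contribute the same term, hence the halves. *)
Lemma skew_decomposition W : W ^t* = - W ->
  W - \tr W *: delta_mx 0 0 =
    \sum_(t | t.1 != t.2) ((complex.Re (W t.1 t.2) / 2)%:C *: antisym_mx t.1 t.2 +
                           (complex.Im (W t.1 t.2) / 2)%:C *: sym_mx t.1 t.2) +
    \sum_(i | i != 0) (complex.Im (W i i))%:C *: ('i *: (delta_mx i i - delta_mx 0 0)).
Proof.
move=> Ws.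
have half (x : R) : (x / 2)%:C + (x / 2)%:C = x%:C :> C.
  by rewrite -rmorphD -splitr.
pose S (F : 'I_n.+1 -> 'I_n.+1 -> C) : 'M[C]_n.+1 :=
  \sum_(t : 'I_n.+1 * 'I_n.+1 | t.1 != t.2) F t.1 t.2 *: delta_mx t.1 t.2.
have Sswap F : \sum_(t : 'I_n.+1 * 'I_n.+1 | t.1 != t.2) F t.1 t.2 *: delta_mx t.2 t.1 =
    S (fun i j => F j i).
  rewrite (reindex_inj (h := fun t : 'I_n.+1 * 'I_n.+1 => (t.2, t.1))) /=.
    by apply: eq_bigl => t; rewrite eq_sym.
  by move=> [a b] [c d] [-> ->].
have -> : \sum_(t | t.1 != t.2) ((complex.Re (W t.1 t.2) / 2)%:C *: antisym_mx t.1 t.2 +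
    (complex.Im (W t.1 t.2) / 2)%:C *: sym_mx t.1 t.2) = S W.
  under eq_bigr do rewrite scalerBr scalerA scalerDr addrACA -scalerDl.
  rewrite big_split /=.
  under [X in _ + X]eq_bigr do rewrite -scaleNr -scalerDl.
  rewrite (Sswap (fun i j =>
    - (complex.Re (W i j) / 2)%:C + (complex.Im (W i j) / 2)%:C * 'i)).
  rewrite -big_split /=; apply: eq_bigr => -[i j] /= _; rewrite -scalerDl.
  congr (_ *: _); have [-> ->] := skew_coef i j Ws.
  rewrite mulNr rmorphN opprK addrACA half -mulrDl half mulrC.
  exact/esym/complexE.
have WE : W = S W + \sum_i W i i *: delta_mx i i.
  rewrite {1}(matrix_sum_delta W) pair_big /= (bigID (fun t => t.1 != t.2)) /=.
  congr (_ + _); rewrite (eq_bigl (fun t => t.1 == t.2)); last by move=> t; rewrite negbK.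
  rewrite -(pair_big_dep xpredT (fun i j => i == j) (fun i j => W i j *: delta_mx i j)) /=.
  by apply: eq_bigr => i _; rewrite (big_pred1 i) // => j; rewrite eq_sym.
have WI i : W i i = (complex.Im (W i i))%:C * 'i.
  have [h _] := skew_coef i i Ws.
  have -> : (complex.Im (W i i))%:C * 'i =
      (complex.Re (W i i))%:C + 'i * (complex.Im (W i i))%:C.
    have -> : complex.Re (W i i) = 0 by lra.
    by rewrite add0r mulrC.
  by rewrite -complexE.
rewrite {1}WE -addrA; congr (_ + _).
rewrite /mxtrace scaler_suml -sumrB [LHS](bigD1 0) //= subrr add0r.
by apply: eq_bigr => i _; rewrite scalerA -WI scalerBr.
Qed.

(** The coefficients in [skew_decomposition] are bounded by entries of [W], hence by [s ^+ 2]. *)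
Lemma approximable_skew : approximable (fun s =>
  [set W - \tr W *: delta_mx 0 0 | W in [set W : 'M[C]_n.+1 |
    W ^t* = - W /\ mxnorm W <= s ^+ 2]]).
Proof.
have h1 (t : 'I_n.+1 * 'I_n.+1) : t.1 != t.2 -> _ :=
  fun ne => approximableD (approximable_antisym ne) (approximable_sym ne).
have h2 (i : 'I_n.+1) : i != 0 -> _ := fun ne => approximable_diag ne.
apply: approximable_sub (approximableD
  (approximable_sum (index_enum _) h1) (approximable_sum (index_enum _) h2)).
move=> s _ [W [Ws Ws2] <-]; rewrite skew_decomposition //.
have coef i j : normc (W i j) <= s ^+ 2 by apply: le_trans Ws2; exact: mxnorm_coef.
have s2 : 0 <= s ^+ 2 by exact: sqr_ge0.
have half (x : R) : `|x| <= s ^+ 2 -> `|x / 2| <= s ^+ 2.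
  move=> xs; rewrite normrM normfV (ger0_norm (ler0n _ 2)) ler_pdivrMr // mulr_natr.
  by rewrite mulr2n (le_trans xs) // lerDl.
have Res i j : `|complex.Re (W i j)| <= s ^+ 2.
  apply: le_trans (coef i j); case: (W i j) => a b /=.
  by rewrite -sqrtr_sqr ler_sqrt ?addr_ge0 ?sqr_ge0 // lerDl sqr_ge0.
have Ims i j : `|complex.Im (W i j)| <= s ^+ 2.
  apply: le_trans (coef i j); case: (W i j) => a b /=.
  by rewrite -sqrtr_sqr ler_sqrt ?addr_ge0 ?sqr_ge0 // lerDr sqr_ge0.
eexists; last (eexists; last reflexivity).
  eexists; last reflexivity; move=> t _ /=.
  exists ((complex.Re (W t.1 t.2) / 2)%:C *: antisym_mx t.1 t.2).
    by exists (complex.Re (W t.1 t.2) / 2) => //; exact: half.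
  exists ((complex.Im (W t.1 t.2) / 2)%:C *: sym_mx t.1 t.2) => //.
  by exists (complex.Im (W t.1 t.2) / 2) => //; exact: half.
eexists; last reflexivity; move=> i _ /=.
by exists (complex.Im (W i i)) => //; exact: Ims.
Qed.

End Decomposition.

(** * Self-improvement of the density of a subgroup *)

Section Improvement.
Variables (R : realType) (n : nat).
Local Notation C := R[i].
Local Notation k := ((n.+1 * n.+1)%:R : R).
Implicit Types (A B W : 'M[C]_n.+1) (g h : SU R n.+1) (H : set (SU R n.+1)).

(** By telescoping, one factor at a time. The bound 2 on the factors, instead of 1, makes room for
    matrices that are merely close to unitary ones. *)
Lemma normc_prodB (I : Type) (r : seq I) (a b : I -> C) :
  (forall i, normc (a i) <= 2) -> (forall i, normc (b i) <= 2) ->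
  normc (\prod_(i <- r) a i - \prod_(i <- r) b i) <=
    2 ^+ size r * \sum_(i <- r) normc (a i - b i).
Proof.
move=> ha hb.
have prod_le (s : seq I) : normc (\prod_(i <- s) a i) <= 2 ^+ size s.
  elim: s => [|i s IHs]; first by rewrite big_nil normc1.
  by rewrite big_cons normcM exprS; apply: ler_pM => //; exact: normc_ge0.
elim: r => [|i r IHr]; first by rewrite !big_nil subrr normc0 mulr0.
rewrite !big_cons.
have -> : a i * \prod_(j <- r) a j - b i * \prod_(j <- r) b j =
    (a i - b i) * \prod_(j <- r) a j + b i * (\prod_(j <- r) a j - \prod_(j <- r) b j).
  by ring.
apply: le_trans (le_normcD _ _) _; rewrite [leRHS]mulrDr !normcM; apply: lerD.
  rewrite mulrC ler_wpM2r ?normc_ge0 //; apply: le_trans (prod_le r) _ => /=.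
  by rewrite exprS ler_peMl ?exprn_ge0 // ler1n.
by rewrite /= exprS -mulrA; apply: ler_pM => //; exact: normc_ge0.
Qed.

Lemma normc_detB A B : (forall i j, normc (A i j) <= 2) ->
  (forall i j, normc (B i j) <= 2) ->
  normc (\det A - \det B) <= (n.+1)`!%:R * (2 ^+ n.+1 * mxnorm (A - B)).
Proof.
move=> hA hB; rewrite /determinant -sumrB mulr_natl -card_Sn -sumr_const.
apply: le_trans (le_normc_sum _ _) _; apply: ler_sum => /= p _.
rewrite -mulrBr normcM.
have -> : normc ((-1) ^+ p : C) = 1.
  by case: (odd_perm p); rewrite ?expr0 ?expr1 ?normcN normc1.
rewrite mul1r; apply: le_trans (normc_prodB _ _ _) _ => [i|i|]; [exact: hA|exact: hB|].
have -> : size (index_enum 'I_n.+1) = n.+1 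
  by rewrite [index_enum _]unlock -enumT size_enum_ord.
rewrite ler_wpM2l ?exprn_ge0 //; apply: ler_sum => i _.
rewrite (bigD1 (p i)) //= !mxE lerDl; apply: sumr_ge0 => j _; exact: normc_ge0.
Qed.

Lemma det_1add_delta (t : C) : \det (1%:M + t *: delta_mx 0 0 : 'M[C]_n.+1) = 1 + t.
Proof.
rewrite det_trig.
  rewrite (bigD1 0) //= !mxE !eqxx mulr1 big1 ?mulr1 // => i i0.
  by rewrite !mxE eqxx (negPf i0) mulr0 addr0.
apply/is_trig_mxP => i j ij.
have ne : (i == j) = false by apply/eqP => e; rewrite e ltnn in ij.
rewrite !mxE ne add0r; case: (eqVneq i 0) => [i0|_]; last by rewrite mulr0.
case: (eqVneq j 0) => [j0|_]; last by rewrite mulr0.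
by rewrite i0 j0 ltnn in ij.
Qed.

Lemma mxtrace_le W : normc (\tr W) <= mxnorm W.
Proof.
apply: le_trans (le_normc_sum _ _) _; apply: ler_sum => i _.
rewrite [leRHS](bigD1 i) //= lerDl; apply: sumr_ge0 => j _; exact: normc_ge0.
Qed.

Lemma mxnorm_delta00 : mxnorm (delta_mx 0 0 : 'M[C]_n.+1) = 1.
Proof.
rewrite /mxnorm (bigD1 0) //= (bigD1 0) //= mxE !eqxx normc1.
rewrite big1 => [|j /negPf j0]; last by rewrite mxE j0 andbF normc0.
rewrite big1 => [|i /negPf i0]; first by rewrite !addr0.
by apply: big1 => j _; rewrite mxE i0 normc0.
Qed.

Lemma skewpart_skew A :
  ((2^-1)%:C *: (A - A ^t*)) ^t* = - ((2^-1)%:C *: (A - A ^t*)).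
Proof.
rewrite linearZ /= map_mxZ linearB /= map_mxB trmxCK -scalerN opprB.
by congr (_ *: _); exact: conjc_real.
Qed.

Lemma mxnorm_skewpart A : mxnorm ((2^-1)%:C *: (A - A ^t*)) <= mxnorm A.
Proof.
rewrite mxnormZ normc_real ger0_norm ?invr_ge0 // mulrC ler_pdivrMr // mulr_natr mulr2n.
by rewrite (le_trans (mxnormB _ _)) // mxnorm_trC.
Qed.

(** Expanding the unitarity of [1 + A] gives [A + A ^t* = - A *m A ^t*], so the Hermitian part of
    [A] is quadratic in [A]. *)
Lemma unitary_skewpart A : A + 1%:M \is unitarymx ->
  mxnorm (A - (2^-1)%:C *: (A - A ^t*)) <= mxnorm A ^+ 2.
Proof.
move=> /unitarymxP uA.
have AA : A + A ^t* = - (A *m A ^t*).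
  move: uA; rewrite linearD /= map_mxD trmx1 map_mx1 mulmxDr !mulmxDl !mulmx1 mul1mx addrA.
  move=> /(canRL (addrK _)); rewrite subrr => gg.
  have {}gg : A *m A ^t* + A ^t* + A = 0 := gg.
  by apply/eqP; rewrite -addr_eq0 addrC [A + _]addrC addrA; apply/eqP.
have -> : A - (2^-1)%:C *: (A - A ^t*) = (2^-1)%:C *: (A + A ^t*).
  have e : 1 = (2^-1)%:C + (2^-1)%:C :> C by rewrite -rmorphD -[2^-1]mul1r -splitr.
  by rewrite scalerBr scalerDr -{1}[A]scale1r {1}e scalerDl opprB addrA addrAC addrK.
rewrite AA mxnormZ normc_real mxnormN ger0_norm ?invr_ge0 // mulrC.
rewrite ler_pdivrMr // (le_trans (mxnormM _ _)) // mxnorm_trC -expr2 ler_peMr ?ler1n //.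
by rewrite exprn_ge0 // mxnorm_ge0.
Qed.

(** For [g] within [s ^+ 2] of the identity, [g - 1] is skew-Hermitian up to [O(s ^+ 4)], which
    reduces the claim to [approximable_skew]. *)
Lemma approximable_SU : exists2 c : R, 0 <= c &
  forall s H, 0 < s <= 1 -> is_subgroup H -> dense_upto (s ^+ 2) H ->
  forall g, mxnorm (SUval g - 1%:M) <= s ^+ 2 ->
  exists2 h, H h & mxnorm (SUval (h^-1 * g)%g - 1%:M) <= c * s ^+ 3.
Proof.
have [c c0 hc] := approximable_skew R n.
have k0 : 0 <= k by rewrite ler0n.
pose L : R := (n.+1)`!%:R * 2 ^+ n.+1.
have L0 : 0 <= L by rewrite mulr_ge0 ?exprn_ge0.
pose c' := k * (2 * c) + k * (c + 1).
have c'0 : 0 <= c' by rewrite /c' addr_ge0 ?mulr_ge0 ?addr_ge0.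
exists (L * c' + c'); first by rewrite addr_ge0 // mulr_ge0.
move=> s H s1 sH dH g g1; have /andP[s0 sle1] := s1.
have s3 : 0 <= s ^+ 3 by rewrite exprn_ge0 // ltW.
have s32 : s ^+ 3 <= s ^+ 2 by rewrite (exprSr s 2) ler_piMr ?sqr_ge0.
have s43 : s ^+ 2 * s ^+ 2 <= s ^+ 3.
  by rewrite -exprD (exprSr s 3) ler_piMr.
pose A := SUval g - 1%:M; pose W := (2^-1)%:C *: (A - A ^t*).
have Ws : W ^t* = - W by exact: skewpart_skew.
have nW : mxnorm W <= s ^+ 2 by apply: le_trans (mxnorm_skewpart _) g1.
(* The approximation misses only the direction [E] of the trace; comparing
   determinants at the end shows that the trace is [O(s ^+ 3)]. *)
pose E : 'M[C]_n.+1 := \tr W *: delta_mx 0 0.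
have nE : mxnorm E <= s ^+ 2.
  by rewrite mxnormZ mxnorm_delta00 mulr1; apply: le_trans (mxtrace_le _) nW.
have [|nWE [h Hh hWE]] := hc s H s1 sH dH (W - E); first by exists W.
have nAW : mxnorm (A - W) <= s ^+ 3.
  apply: le_trans (unitary_skewpart _) _; first by rewrite /A subrK SU_unitary.
  apply: le_trans s43; rewrite -expr2.
  by rewrite ler_pXn2r // nnegrE ?mxnorm_ge0 ?sqr_ge0.
pose F := SUval g - SUval h - E.
have nF : mxnorm F <= (c + 1) * s ^+ 3.
  have -> : F = (A - W) - (SUval h - 1%:M - (W - E)).
    by rewrite /F /A; apply/matrixP => i j; rewrite !mxE; ring.
  by rewrite [c + 1]addrC mulrDl mul1r; apply: mxnormB_le.
have nh : mxnorm (SUval h^-1%g - 1%:M) <= k * (2 * c * s ^+ 2).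
  have := mxnorm_SUVB 1%g h; rewrite mulg1 => /le_trans; apply.
  rewrite ler_wpM2l // SUval1 mxnorm_distC -[_ - _](subrK (W - E)).
  rewrite -mulrA mulr_natl mulr2n; apply: mxnormD_le nWE.
  by apply: le_trans hWE _; rewrite ler_wpM2l.
(* Passing from [g - h] to [h^-1 * g - 1] perturbs [E] only by [(h^-1 - 1) E], a product of two
   terms [O(s ^+ 2)]. *)
pose F' := SUval (h^-1 * g)%g - 1%:M - E.
have nF' : mxnorm F' <= c' * s ^+ 3.
  have -> : F' = (SUval h^-1%g - 1%:M) *m E + SUval h^-1%g *m F.
    rewrite /F' /F SUvalM mulmxBl mul1mx !mulmxBr SUvalVM.
    move: (_ *m E) (_ *m SUval g) => S T.
    by apply/matrixP => i j; rewrite !mxE; ring.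
  rewrite mulrDl; apply: mxnormD_le.
    apply: le_trans (mxnormM_le nh nE) _.
    by rewrite -mulrA -[2 * c * _ * _]mulrA mulrA ler_wpM2l // !mulr_ge0.
  by rewrite -mulrA; apply: mxnormM_le nF; exact: mxnorm_SU.
(* The element [h^-1 * g] has determinant 1 and [1 + E] has determinant [1 + \tr W], while the two
   matrices differ by [F']. *)
have ntr : normc (\tr W) <= L * c' * s ^+ 3.
  have := @normc_detB (SUval (h^-1 * g)%g) (1%:M + E).
  rewrite det_1add_delta SU_det opprD addrA subrr add0r normcN.
  have -> : SUval (h^-1 * g)%g - (1%:M + E) = F' by rewrite /F' opprD addrA.
  move=> /(_ _ _)/le_trans; apply => [i j|i j|].
  - by rewrite (le_trans (normc_unitary _ _ (SU_unitary _))) // ler1n.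
  - rewrite mxE; apply: le_trans (le_normcD _ _) _; rewrite [2]mulr2n; apply: lerD.
      by rewrite mxE; case: eqP; rewrite ?normc1 ?normc0.
    apply: le_trans (mxnorm_coef _ _ _) (le_trans nE _).
    by rewrite expr_le1 // ltW.
  - by rewrite -mulrA /L -mulrA ler_wpM2l // ler_wpM2l // exprn_ge0.
exists h => //; rewrite -[_ - _](subrK E) mulrDl addrC; apply: mxnormD_le nF'.
by rewrite mxnormZ mxnorm_delta00 mulr1.
Qed.

(** The threshold [s] is the same for all subgroups [H]; this uniformity yields a fixed Hausdorff
    radius in [full_open]. *)
Lemma subgroup_self_improving : exists2 s : R, 0 < s <= 1 &
  forall H, is_subgroup H -> dense_upto (s ^+ 2) H ->
  forall e, 0 < e -> dense_upto e H.
Proof.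
have [c c0 hc] := approximable_SU.
(* For [s <= s0] one has [c * s <= 1 / 4], so that [c * s ^+ 3 <= (s / 2) ^+ 2]; the summand 1 also
   ensures [s0 <= 1]. *)
pose s0 : R := (4 * (c + 1))^-1.
have d0 : 0 < 4 * (c + 1) by rewrite mulr_gt0 // ltr_wpDl.
have s00 : 0 < s0 by rewrite invr_gt0.
have s01 : s0 <= 1.
  by rewrite invf_le1 //; lra.
exists s0; first by rewrite s00.
move=> H sH dH; have [_ HM _] := sH.
have step s : 0 < s <= s0 -> dense_upto (s ^+ 2) H -> dense_upto ((s / 2) ^+ 2) H.
  move=> /andP[sgt0 ss0] ds g; have [h0 Hh0 gh0] := ds g.
  have [|h Hh gh] := hc s H _ sH ds _ gh0; first by rewrite sgt0 (le_trans ss0).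
  (* [h0] approximates [g] up to [s ^+ 2], and [h] approximates the remainder [h0^-1 * g], which is
     that close to the identity. *)
  exists (h0 * h)%g; first exact: HM.
  rewrite invgM -mulgA; apply: le_trans gh _.
  have : s * (4 * (c + 1)) <= 1.
    by rewrite -ler_pdivlMr // mul1r.
  move=> sc; rewrite exprMn (exprS s 2) mulrA [leRHS]mulrC ler_wpM2r ?sqr_ge0 //.
  by rewrite expr2; lra.
have dk m : dense_upto ((s0 / 2 ^+ m) ^+ 2) H.
  elim: m => [|m IHm]; first by rewrite expr0 divr1.
  rewrite (exprSr 2 m) invfM mulrA; apply: step => //.
  rewrite divr_gt0 ?exprn_gt0 //= ler_piMr ?(ltW s00) // invf_le1 ?exprn_gt0 //.
  by rewrite exprn_ege1 // ler1n.
move=> e e0 g.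
pose m := Num.bound e^-1.
have [h Hh gh] := dk m g; exists h => //; apply: le_trans gh _.
have me : e^-1 < 2 ^+ m.
  apply: lt_le_trans (archi_boundP _) _; first by rewrite invr_ge0 ltW.
  by rewrite -natrX ler_nat ltnW // ltn_expl.
have p0 : 0 < (2 : R) ^+ m by rewrite exprn_gt0.
apply: (@le_trans _ _ (2 ^+ m)^-1); last first.
  by rewrite -[e]invrK lef_pV2 ?posrE ?invr_gt0 // ltW.
have t0 : 0 <= s0 / 2 ^+ m by rewrite divr_ge0 // ltW.
have tm : s0 / 2 ^+ m <= (2 ^+ m)^-1 by rewrite ler_piMl // invr_ge0 ltW.
have m1 : (2 ^+ m)^-1 <= 1 :> R by rewrite invf_le1 // exprn_ege1 // ler1n.
rewrite expr2; apply: le_trans tm.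
by rewrite ler_piMr // (le_trans _ m1) // ler_piMl // invr_ge0 ltW.
Qed.

End Improvement.

(** * The topology of SU(n) *)

Section SUTopology.
Variables (R : realType) (n : nat).
Local Notation C := R[i].
Local Notation k := ((n.+1 * n.+1)%:R : R).
Implicit Types (A B : 'M[C]_n.+1) (g h : SU R n.+1).

Lemma nbhs_mxnorm A (S : set 'M[C]_n.+1) : nbhs A S <->
  exists2 e : R, 0 < e & [set B | mxnorm (B - A) < e] `<=` S.
Proof.
split=> [/nbhs_ballP [e /= e0 eS]|[e e0 eS]].
  (* The radii of balls of complex matrices are themselves complex numbers; being positive forces
     [e] to be real. *)
  have eE : e = (complex.Re e)%:C.
    by move: e0; case: (e) => a b; rewrite ltcE /= => /andP[/eqP -> _].
  exists (complex.Re e); first by rewrite -ltcR -eE.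
  move=> B /= AB; apply: eS; split=> // i j; rewrite /ball /= eE.
  rewrite -[X in X < _]/((normc (A i j - B i j))%:C) ltcR.
  apply: le_lt_trans AB; rewrite mxnorm_distC.
  by have := mxnorm_coef (A - B) i j; rewrite !mxE.
have d0 : 0 < e / (k + 1) by rewrite divr_gt0 // ltr_wpDl // ler0n.
apply/nbhs_ballP; exists (e / (k + 1))%:C; first by rewrite /= ltcR.
move=> B [_ AB]; apply: eS => /=.
apply: (@le_lt_trans _ _ (k * (e / (k + 1)))).
  rewrite mxnorm_distC; apply: mxnorm_le => i j; rewrite !mxE.
  have := AB i j; rewrite /ball /= -[X in X < _]/((normc (A i j - B i j))%:C) ltcR.
  exact: ltW.
by rewrite mulrA ltr_pdivrMr ?ltr_wpDl // ?ler0n // mulrC ltr_pM2l // ltrDl.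
Qed.

Lemma nbhs_SU g (S : set (SU R n.+1)) : nbhs g S <->
  exists2 e : R, 0 < e & [set h | mxnorm (SUval h - SUval g) < e] `<=` S.
Proof.
split.
  move=> [_ [[B oB <-] Bg BS]].
  have /nbhs_mxnorm [e e0 eB] : nbhs (SUval g) B by apply: open_nbhs_nbhs.
  by exists e => // h gh; apply: BS; apply: eB.
move=> [e e0 eS]; apply: (filterS eS).
have c := @initial_continuous _ _ (@SUval R n.+1) g.
by apply: (c [set B | mxnorm (B - SUval g) < e]); apply/nbhs_mxnorm; exists e.
Qed.

(** Both defining equations are violated by at most a constant times the distance from [A] to an
    element of the group. *)
Lemma SU_limit A : (forall e : R, 0 < e -> exists g, mxnorm (SUval g - A) < e) ->
  (A \is unitarymx) && (\det A == 1).
Proof.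
move=> hA.
have k0 : 0 <= k by rewrite ler0n.
(* The restriction [e <= 1] serves the determinant: it keeps the entries of [A] within the bound 2
   of [normc_detB]. *)
have small (x c : R) : 0 <= c ->
    (forall e, 0 < e -> e <= 1 -> x <= c * e) -> x <= 0.
  move=> c0 h; apply/ler_addgt0Pr => e e0; rewrite add0r.
  have e'0 : 0 < Num.min 1 (e / (c + 1)).
    by rewrite lt_min ltr01 divr_gt0 // ltr_wpDl.
  apply: (le_trans (h _ e'0 _)); first by rewrite ge_min lexx.
  apply: (@le_trans _ _ (c * (e / (c + 1)))).
    by rewrite ler_wpM2l // ge_min lexx orbT.
  by rewrite mulrA ler_pdivrMr ?ltr_wpDl // mulrC ler_pM2l // lerDl.
apply/andP; split.
  apply/unitarymxP/eqP; rewrite -subr_eq0; apply/eqP.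
  suff h0 : mxnorm (A *m A ^t* - 1%:M) <= 0.
    apply/matrixP => i j; rewrite [RHS]mxE; apply: eq0_normc; apply/eqP.
    by rewrite eq_le normc_ge0 andbT; apply: le_trans h0; exact: mxnorm_coef.
  apply: (small _ (mxnorm A + k)); first by rewrite addr_ge0 ?mxnorm_ge0.
  move=> e e0 _; have [g /ltW gA] := hA e e0.
  have -> : A *m A ^t* - 1%:M = (A - SUval g) *m A ^t* + SUval g *m (A - SUval g) ^t*.
    have /unitarymxP gg := SU_unitary g.
    have cB : (A - SUval g) ^t* = A ^t* - (SUval g) ^t* by rewrite linearB /= map_mxB.
    by rewrite cB mulmxBl mulmxBr gg addrA subrK.
  rewrite mulrDl [mxnorm A * _]mulrC; apply: mxnormD_le; apply: mxnormM_le.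
  - by rewrite mxnorm_distC.
  - by rewrite mxnorm_trC.
  - exact: mxnorm_SU.
  - by rewrite mxnorm_trC mxnorm_distC.
rewrite -subr_eq0; apply/eqP/eq0_normc/eqP; rewrite eq_le normc_ge0 andbT.
apply: (small _ ((n.+1)`!%:R * 2 ^+ n.+1)); first by rewrite mulr_ge0 ?exprn_ge0.
move=> e e0 e1; have [g /ltW gA] := hA e e0.
have gle i j : normc (SUval g i j) <= 1 by apply: normc_unitary; exact: SU_unitary.
rewrite -(SU_det g) -mulrA.
apply: le_trans (normc_detB _ _) _ => [i j|i j|].
- rewrite -[A](subrK (SUval g)) mxE; apply: le_trans (le_normcD _ _) _.
  rewrite [2]mulr2n; apply: lerD => //; apply: le_trans (mxnorm_coef _ _ _) _.
  by rewrite mxnorm_distC (le_trans gA).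
- by rewrite (le_trans (gle i j)) // ler1n.
- by rewrite ler_wpM2l // ler_wpM2l ?exprn_ge0 // mxnorm_distC.
Qed.

(** The box is a continuous image of a product of intervals, compact by Tychonoff. The boolean in
    the index selects the real part ([true]) or the imaginary part ([false]) of an entry. *)
Lemma mx_box_compact : compact [set A : 'M[C]_n.+1 | forall i j,
  -1 <= complex.Re (A i j) <= 1 /\ -1 <= complex.Im (A i j) <= 1].
Proof.
pose I := ('I_n.+1 * 'I_n.+1 * bool)%type.
pose T := prod_topology (fun _ : I => R).
pose F (f : T) : 'M[C]_n.+1 := \matrix_(i, j) (f (i, j, true) +i* f (i, j, false)).
have cK : compact [set f : T | forall t, `[-1, 1]%classic (f t)].
  have := @tychonoff I (fun _ => R) (fun _ => `[-1, 1]%classic).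
  by apply=> t; exact: segment_compact.
have -> : [set A : 'M[C]_n.+1 | forall i j,
    -1 <= complex.Re (A i j) <= 1 /\ -1 <= complex.Im (A i j) <= 1] =
    F @` [set f : T | forall t, `[-1, 1]%classic (f t)].
  apply/seteqP; split=> [A hA|_ [f hf <-] i j].
    exists (fun t : I => if t.2 then complex.Re (A t.1.1 t.1.2)
                         else complex.Im (A t.1.1 t.1.2)).
      by move=> [[i j] []] /=; rewrite in_itv /=; have [] := hA i j.
    by apply/matrixP => i j; rewrite mxE /=; case: (A i j).
  have := hf (i, j, true); have := hf (i, j, false).
  by rewrite !mxE /= !in_itv.
suff cF : forall (f : T) S, nbhs (F f) S -> nbhs f (F @^-1` S).
  by apply: continuous_compact cK; apply: continuous_subspaceT => f S; exact: cF.
move=> f S /nbhs_mxnorm [e e0 eS].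
pose d := e / (2 * (k + 1)).
have d0 : 0 < d by rewrite divr_gt0 // mulr_gt0 // ltr_wpDl // ler0n.
have near_f : nbhs f [set f' : T | forall t : I, `|f t - f' t| < d].
  have FF : Filter (nbhs f) by exact: nbhs_filter.
  apply: (@filter_forall T I (fun t f' => `|f t - f' t| < d) (nbhs f) FF) => t.
  have h := @proj_continuous I (fun _ => R) t f.
  have nt : nbhs (f t) [set x | `|f t - x| < d] by apply/nbhs_ballP; exists d.
  exact: h nt.
apply: (filterS _ near_f) => f' ff'; apply: eS => /=.
apply: (@le_lt_trans _ _ (k * (2 * d))).
  rewrite mxnorm_distC; apply: mxnorm_le => i j; rewrite !mxE.
  rewrite -[X in normc X]/((f (i, j, true) - f' (i, j, true)) +i*
                           (f (i, j, false) - f' (i, j, false))).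
  rewrite [X in normc X]complexE; apply: le_trans (le_normcD _ _) _; rewrite mulr_natl mulr2n.
  have ni : normc ('i : C) = 1 by rewrite /= expr0n expr1n add0r sqrtr1.
  rewrite normcM ni mul1r !normc_real.
  by apply: lerD; apply: ltW; exact: ff'.
have kk : 0 < k + 1 by rewrite ltr_wpDl // ler0n.
rewrite /d; have -> : k * (2 * (e / (2 * (k + 1)))) = k * e / (k + 1).
  by field; rewrite gt_eqF.
by rewrite ltr_pdivrMr // mulrC ltr_pM2l // ltrDl.
Qed.

(** A filter on the group, pushed to matrices, lives in the compact box and clusters at some [A]. By
    [SU_limit], [A] is in the group, and it is a cluster point there since the topology is induced
    by that of matrices. *)
Lemma SU_compact : compact [set: SU R n.+1].
Proof.
move=> F FF _.
pose G : set_system 'M[C]_n.+1 := @SUval R n.+1 @ F.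
have GF : ProperFilter G by exact: fmap_proper_filter.
have [|A [_ cA]] := mx_box_compact GF.
  apply: (@filterS _ F _ setT); last exact: filterT.
  move=> g _ i j; have := normc_unitary i j (SU_unitary g).
  case: (SUval g i j) => a b /= ab.
  have ab1 : a ^+ 2 + b ^+ 2 <= 1.
    rewrite -[leRHS](expr1n _ 2) -[leLHS]sqr_sqrtr ?addr_ge0 ?sqr_ge0 //.
    by rewrite ler_pXn2r ?nnegrE.
  split; rewrite -ler_norml -(@expr_le1 _ 2) // real_normK ?num_real //.
    by apply: le_trans ab1; rewrite lerDl sqr_ge0.
  by apply: le_trans ab1; rewrite lerDr sqr_ge0.
have meet S (e : R) : F S -> 0 < e -> exists2 g, S g & mxnorm (SUval g - A) < e.
  move=> FS e0; have [] := cA (@SUval R n.+1 @` S) [set B | mxnorm (B - A) < e].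
  - by apply: (@filterS _ F _ S) => //; exact: preimage_image.
  - by apply/nbhs_mxnorm; exists e.
  by move=> _ [[g Sg <-] gA]; exists g.
have PA : (A \is unitarymx) && (\det A == 1).
  apply: SU_limit => e e0.
  by have [g _ gA] := meet setT e filterT e0; exists g.
exists (MkSU PA); split=> // S V FS /nbhs_SU [e e0 eV].
by have [g Sg gA] := meet S e FS e0; exists g; split=> //; apply: eV.
Qed.

End SUTopology.

(** * Subgroups with full projections *)

Section FullProjections.
Variables (R : realType) (d : forall n : nat, biinv_metric R n.+1).
Local Notation S := (subgroup_space d).
Local Notation pr n := (@proj nat (fun n => SU R n.+1) n).
Local Notation full n := [set G : S | pr n @` csval G = [set: SU R n.+1]].

Lemma dense_compact_full n (K : set (SU R n.+1)) : compact K ->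
  (forall e, 0 < e -> dense_upto e K) -> K = [set: SU R n.+1].
Proof.
move=> cK dK; apply/seteqP; split=> // g _.
have : closed K by apply: compact_closed cK; exact: (SU_hausdorff d).
apply=> V /nbhs_SU [e e0 eV].
pose k : R := (n.+1 * n.+1)%:R.
have k0 : 0 < k + 1 by rewrite ltr_wpDl // ler0n.
have [h Kh gh] := dK (e / (k + 1)) (divr_gt0 e0 k0) g.
exists h; split=> //; apply: eV => /=; rewrite mxnorm_distC.
apply: le_lt_trans (mxnorm_SUB _ _) _.
apply: (@le_lt_trans _ _ (k * (e / (k + 1)))); first by rewrite ler_wpM2l // ler0n.
by rewrite mulrA ltr_pdivrMr // mulrC ltr_pM2l // ltrDl.
Qed.

Lemma proj_subgroup n (G : S) : is_subgroup (pr n @` csval G).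
Proof.
have gG := cs_group (G : compact_subgroup R).
have [G1 _] := gG; rewrite inE in G1.
split; first by exists 1%g.
  move=> _ _ [x Gx <-] [y Gy <-]; exists (x * y)%g => //.
  by have := group_closedM gG (mem_set Gx) (mem_set Gy); rewrite inE.
move=> _ [x Gx <-]; exists (x^-1)%g => //.
by have := group_closedV gG (mem_set Gx); rewrite inE.
Qed.

Lemma proj_compact n (G : S) : compact (pr n @` csval G).
Proof.
apply: continuous_compact; last exact: cs_compact.
by apply: continuous_subspaceT => x; exact: proj_continuous.
Qed.

(** If the projection of [G] is full, that of a nearby [G'] is dense up to the threshold of
    [subgroup_self_improving], hence dense, hence full by compactness. *)
Lemma full_open n : open (full n).
Proof.
have [s /andP[s0 _] hs] := subgroup_self_improving R n.
have [e0 e00 he0] : exists2 e : R, 0 < e &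
    [set y | d n 1%g y < e] `<=` [set y | mxnorm (SUval y - 1%:M) < s ^+ 2].
  by apply/(bdist_nbhs (d n)); apply/nbhs_SU; exists (s ^+ 2); rewrite ?exprn_gt0.
have p0 : 0 < (2^-1 : R) ^+ n.+1 by rewrite exprn_gt0.
rewrite openE => G Gfull; apply/nbhs_ballP.
(* The factor compensates for the weight of coordinate [n] in [SUdist]. *)
exists (2^-1 ^+ n.+1 * e0); first exact: mulr_gt0.
move=> G'; rewrite ballEmdist => GG'.
apply: dense_compact_full; first exact: proj_compact.
apply: hs; first exact: proj_subgroup.
move=> g; have [x Gx xg] : (pr n @` csval G) g by rewrite Gfull.
have G'0 := compact_subgroup_neq0 (G' : compact_subgroup R).
have lt1 : dist_to_set (SUdist d) x (csval G') < 2^-1 ^+ n.+1 * e0.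
  apply: le_lt_trans GG'; rewrite /mdist /= /subgroup_dist /hausdorff_dist le_max.
  by rewrite (le_excess (SUdist_ge0 d) (SUdist_bounded d)).
have := lt1; rewrite -subr_gt0 => gap0.
have [y G'y xy] := dist_to_set_lt (SUdist_ge0 d) x G'0 gap0.
exists (pr n y); first by exists y.
apply/ltW/he0 => /=.
(* Left invariance moves the comparison to the identity, so that the single radius [e0] serves every
   [g]. *)
have -> : d n 1%g ((pr n y)^-1 * g)%g = d n (x n) (y n).
  by rewrite -(bdistMl (d n) (y n)) mulg1 mulVKg -xg bdist_sym.
rewrite -(ltr_pM2l p0); apply: le_lt_trans (SUdist_ge_term d x y n) _.
by apply: lt_le_trans xy _; rewrite addrC subrK.
Qed.

(** * Splicing a subgroup with free later coordinates *)

Lemma SUdist_tail (x y : SUprod R) N : (forall i, (i < N)%N -> x i = y i) ->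
  SUdist d x y <= 2^-1 ^+ N.
Proof.
move=> xy; pose t i : R := 2^-1 ^+ i.+1 * d i (x i) (y i).
have head : series t N = 0.
  rewrite /series /= big_nat_cond big1 // => i /andP[/andP[_ iN] _].
  by rewrite /t xy // bdistxx mulr0.
have bound j : series t (N + j)%N + 2^-1 ^+ (N + j) <= 2^-1 ^+ N.
  elim: j => [|j IHj]; first by rewrite addn0 head add0r.
  apply: le_trans IHj; rewrite addnS seriesS [t _ + _]addrC -addrA lerD2l.
  have h : t (N + j)%N <= 2^-1 ^+ (N + j).+1 by rewrite ler_piMr ?exprn_ge0 // bdist_le1.
  apply: le_trans (lerD h (lexx _)) _.
  by rewrite exprS -mulrDl -[2^-1]mul1r -splitr !mul1r.
apply: limr_le; first exact: is_cvg_SUdist.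
exists N => // m /= Nm; rewrite -(subnKC Nm).
by apply: le_trans (bound (m - N)%N); rewrite -[leLHS]addr0 lerD2l exprn_ge0.
Qed.

Definition splice N (p : SUprod R * SUprod R) : SUprod R :=
  fun i => if (i < N)%N then p.1 i else p.2 i.

Lemma splice_continuous N : continuous (splice N).
Proof.
move=> p; apply/cvg_sup => i U [_ [[W oW <-] Wp WU]].
apply: (filterS WU) => {U WU}; rewrite nbhs_simpl /=.
have WN : nbhs (splice N p i) W by exact: open_nbhs_nbhs.
have pc := @proj_continuous nat (fun n => SU R n.+1) i.
rewrite /preimage /= /splice; move: WN; rewrite /splice; case: ltnP => _ WN.
  exists (pr i @^-1` W, setT); last by move=> [a b] [].
  by split; [exact: (pc p.1 W WN)|exact: filterT].
exists (setT, pr i @^-1` W); last by move=> [a b] [].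
by split; [exact: filterT|exact: (pc p.2 W WN)].
Qed.

(** Written as an image so that compactness follows from the continuity of [splice N], and closure
    under the group operations from its being a homomorphism. *)
Definition spliced N (G : S) : set (SUprod R) := splice N @` (csval G `*` setT).

Lemma spliced_compact N (G : S) : compact (spliced N G).
Proof.
apply: continuous_compact; first by apply: continuous_subspaceT; exact: splice_continuous.
apply: compact_setX; first exact: cs_compact.
have := @tychonoff nat (fun n => SU R n.+1) (fun _ => setT) (fun n => @SU_compact R n).
by congr compact; apply/seteqP; split.
Qed.

Lemma spliced_group N (G : S) : group_closed (mem (spliced N G)).
Proof.
have [G1 GV] := cs_group (G : compact_subgroup R).
split.
  rewrite inE; exists (1%g, 1%g); first by split=> //; rewrite inE in G1.
  by apply: functional_extensionality_dep => i; rewrite /splice; case: ifP.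
move=> u v; rewrite !inE => -[[x x'] [Gx _] <-] [[y y'] [Gy _] <-].
exists ((x / y)%g, (x' / y')%g).
  by split=> //; have := GV x y (mem_set Gx) (mem_set Gy); rewrite inE.
apply: functional_extensionality_dep => i.
rewrite -[RHS]/((splice N (x, x') i / splice N (y, y') i)%g) /splice /=.
by case: ifP.
Qed.

Definition splice_group N (G : S) : S :=
  CompactSubgroup (@spliced_compact N G) (@spliced_group N G).

Lemma splice_group_full N (G : S) n : (N <= n)%N -> full n (splice_group N G).
Proof.
move=> Nn; apply/seteqP; split=> // g _.
have [x Gx] := compact_subgroup_neq0 (G : compact_subgroup R).
pose y : SUprod R := dfwith (fun i => 1%g : SU R i.+1) n g.
exists (splice N (x, y)); first by exists (x, y).
by rewrite /proj /splice ltnNge Nn /= /y dfwithin.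
Qed.

(** One excess is at most 0 because [G] lies in the spliced group, as [splice N (x, x) = x]. For the
    other, [splice N (x, y)] is compared with [x], with which it shares the first [N]
    coordinates. *)
Lemma splice_group_dist N (G : S) : subgroup_dist G (splice_group N G) <= 2^-1 ^+ N.
Proof.
rewrite /subgroup_dist /hausdorff_dist ge_max; apply/andP; split; apply: excess_le.
- exact: compact_subgroup_neq0.
- move=> x Gx; apply: (@le_trans _ _ 0); last by rewrite exprn_ge0.
  rewrite -(SUdistxx d x); apply: dist_to_set_le; first exact: SUdist_ge0.
  exists (x, x) => //; apply: functional_extensionality_dep => i.
  by rewrite /splice; case: ifP.
- exact: (compact_subgroup_neq0 (splice_group N G : compact_subgroup R)).
move=> _ [[x y] [Gx _] <-].
apply: le_trans (dist_to_set_le (SUdist_ge0 d) _ Gx) _.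
by apply: SUdist_tail => i iN; rewrite /splice iN.
Qed.

Lemma eventually_full_dense m : dense (\bigcup_(n in [set n | (m <= n)%N]) full n).
Proof.
move=> O [G OG] oO.
have /nbhs_ballP [e /= e0 eO] : nbhs G O by exact: open_nbhs_nbhs.
(* [N] exceeds [e^-1] and [2 ^ N] exceeds [N]. *)
pose N := Num.bound e^-1.
have Ne : (2^-1 : R) ^+ N < e.
  rewrite exprVn -[e]invrK ltf_pV2 ?posrE ?exprn_gt0 ?invr_gt0 //.
  apply: lt_trans (archi_boundP _) _; first by rewrite invr_ge0 ltW.
  by rewrite -natrX ltr_nat ltn_expl.
exists (splice_group N G); split.
  by apply: eO; rewrite ballEmdist /=; apply: le_lt_trans Ne; exact: splice_group_dist.
exists (maxn m N); first by rewrite /= leq_maxl.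
by apply: splice_group_full; rewrite leq_maxr.
Qed.

End FullProjections.

Theorem theorem5p14 (R : realType) (d : forall n : nat, biinv_metric R n.+1) :
  comeager [set G : subgroup_space d |
    infinite_set [set n : nat |
      @proj nat (fun n => SU R n.+1) n @` csval G = [set: SU R n.+1]]].

Proof.
exists (fun m => \bigcup_(n in [set n | (m <= n)%N])
  [set G : subgroup_space d |
    @proj nat (fun n => SU R n.+1) n @` csval G = [set: SU R n.+1]]).
  by move=> m; split; [apply: bigcup_open => n _; exact: full_open|exact: eventually_full_dense].
move=> G hG /finite_seqP [s sE].
(* If the indices formed a finite list [s], the open set of rank one more than its maximum would
   supply an index beyond all of them. *)
have [n /= sn Gn] := hG (\max_(i <- s) i).+1 I.
have : [set` s] n by rewrite -sE.
by move=> /= ns; move: sn; rewrite ltnNge => /negP; apply; exact: leq_bigmax_seq.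
Qed.
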